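(* (a) For integer parameters $c,E$ there are constants $c_1=c_1(c,E)$, $r=r(c,E)$, $t=t(c,E)$ such that the following holds. Let $f\in\mathbb{C}[x,y,z]$ be irreducible of degree $D\gg E$, and let $\mathcal{C}_0\subseteq\mathcal{C}_{3,E}$ be a constructible set of complexity at most $c$. If there exist at least $c_1D^2$ curves of $\mathcal{C}_0$, each contained in $Z(f)$ and containing at least $c_1D$ points of $Z(f)$ that are $(t,\mathcal{C}_0,r)$-flecnodes, then $Z(f)$ is infinitely ruled by curves of $\mathcal{C}_0$. (b) In particular, if $Z(f)$ is not infinitely ruled by curves of $\mathcal{C}_0$, then, except for at most $c_1D^2$ exceptional curves, every curve of $\mathcal{C}_0$ fully contained in $Z(f)$ is incident to at most $c_1D$ points that are incident to at least $t$ curves of $\mathcal{C}_0$ fully contained in $Z(f)$.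
   Context: $\mathcal{C}_{3,E}$ is the set of irreducible algebraic curves of degree at most $E$ in $\mathbb{C}^3$, viewed as a subset of a parameter space; a constructible set is a Boolean combination of algebraic sets there, and its complexity is the minimal total degree of the defining polynomials. $Z(f)$ is the zero set of $f$. A point $p\in Z(f)$ is a $(t,\mathcal{C}_0,r)$-flecnode if there are at least $t$ curves $\gamma_1,\dots,\gamma_t\in\mathcal{C}_0$ such that each $\gamma_i$ passes through $p$, $p$ is a non-singular point of $\gamma_i$, and $\gamma_i$ osculates to $Z(f)$ to order $r$ at $p$. $Z(f)$ is infinitely ruled by curves of $\mathcal{C}_0$ if every point of $Z(f)$ lies on infinitely many curves of $\mathcal{C}_0$ fully contained in $Z(f)$. *)

(* Defs.v *)
From HB Require Import structures.
From mathcomp Require Import all_boot all_algebra.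
From mathcomp Require Import reals.
From mathcomp Require Import complex.
From mathcomp Require Import mpoly.

Set Implicit Arguments.
Unset Strict Implicit.
Unset Printing Implicit Defensive.

Import GRing.Theory Num.Theory.
Local Open Scope ring_scope.

Section AlgGeom.
Variable K : fieldType.

Definition pt := 'rV[K]_3.
Definition poly3 := {mpoly K[3]}.

Definition ev (p : poly3) (x : pt) : K := p.@[fun j => x ord0 j].

Definition cset := pt -> Prop.
Definition csub (A B : cset) := forall x, A x -> B x.
Definition cseteq (A B : cset) := forall x, A x <-> B x.
Definition cset0 : cset := fun _ => False.

Definition Zf (f : poly3) : cset := fun x => ev f x = 0.

Definition Zs (s : seq poly3) : cset := fun x => forall p, p \in s -> ev p x = 0.

Definition algebraic (A : cset) := exists s : seq poly3, cseteq A (Zs s).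

Definition Iof (A : cset) (p : poly3) := forall x, A x -> ev p x = 0.

Definition cfinite (A : cset) := exists s : seq pt, forall x, A x -> x \in s.
Definition at_most_pts (A : cset) (n : nat) :=
  exists s : seq pt, (size s <= n)%N /\ forall x, A x -> x \in s.

Definition irreducible_alg (A : cset) :=
  [/\ algebraic A, exists x, A x &
      forall B C : cset, algebraic B -> algebraic C ->
        cseteq A (fun x => B x \/ C x) -> cseteq A B \/ cseteq A C].

(* Irreducible algebraic curve: an irreducible algebraic set of dimension 1,
   i.e. infinite, and all of whose proper algebraic subsets are finite. *)
Definition irr_curve (g : cset) :=
  [/\ irreducible_alg g, ~ cfinite g &
      forall B : cset, algebraic B -> csub B g -> ~ cseteq B g -> cfinite B].

Definition plane (a : 'rV[K]_3) (b : K) : cset :=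
  fun x => \sum_(j < 3) a ord0 j * x ord0 j = b.

Definition curve_deg_le (g : cset) (E : nat) :=
  forall a b, a != 0 -> ~ csub g (plane a b) ->
    at_most_pts (fun x => g x /\ plane a b x) E.

Definition in_C3E (E : nat) (g : cset) := irr_curve g /\ curve_deg_le g E.

Definition grad (p : poly3) (x : pt) : 'rV[K]_3 := \row_(i < 3) ev (p^`M(i)) x.

(* p is a non-singular point of the curve g: the Jacobian of I(g) at p has
   rank 2 (= codimension of g). *)
Definition smooth_pt (g : cset) (p : pt) :=
  g p /\ exists g1 g2 : poly3, [/\ Iof g g1, Iof g g2 &
     \rank (col_mx (grad g1 p) (grad g2 p)) = 2%N].

Definition vanishes_to (q : poly3) (p : pt) (k : nat) :=
  forall m : 'X_{1..3}, (mdeg m < k)%N -> ev (q^`M[m]) p = 0.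

(* g osculates to Z(f) to order r at p : f restricted to g vanishes to order
   > r at p, i.e. f is in I(g) + m_p^(r+1). *)
Definition osculates (g : cset) (f : poly3) (p : pt) (r : nat) :=
  exists h : poly3, Iof g h /\ vanishes_to (f - h) p r.+1.

Definition atleast_sets (n : nat) (P : cset -> Prop) :=
  exists gs : seq cset, [/\ (n <= size gs)%N,
    (forall i j, (i < size gs)%N -> (j < size gs)%N -> i != j ->
        ~ cseteq (nth cset0 gs i) (nth cset0 gs j)) &
    forall i, (i < size gs)%N -> P (nth cset0 gs i)].

Definition atleast_pts (n : nat) (P : pt -> Prop) :=
  exists s : seq pt, [/\ (n <= size s)%N, uniq s & forall x, x \in s -> P x].

Definition flecnode (t : nat) (C0 : cset -> Prop) (r : nat) (f : poly3) (p : pt) :=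
  Zf f p /\ atleast_sets t (fun g => [/\ C0 g, smooth_pt g p & osculates g f p r]).

Definition inf_ruled (C0 : cset -> Prop) (f : poly3) :=
  forall p, Zf f p -> forall n : nat,
    atleast_sets n (fun g => [/\ C0 g, csub g (Zf f) & g p]).

Definition mirreducible (f : poly3) :=
  (1 < msize f)%N /\
  forall g h : poly3, f = g * h -> (msize g <= 1)%N \/ (msize h <= 1)%N.

(* A parameter is the coefficient array of a family (g_j)_j of polynomials of
   degree <= E, indexed by the monomials of degree <= E; the curve encoded is
   the common zero set of the g_j.  The parameter space is K^N. *)
Definition Mon (E : nat) := 'X_{1..3 < E.+1}.
Definition Par (E : nat) := (Mon E * Mon E)%type.
Definition Npar (E : nat) := #|{: Par E}|.

Definition gpoly (E : nat) (u : 'rV[K]_(Npar E)) (j : Mon E) : poly3 :=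
  \sum_(m : Mon E) u ord0 (enum_rank (j, m)) *: 'X_[bmnm m].

Definition Zpar (E : nat) (u : 'rV[K]_(Npar E)) : cset :=
  fun x => forall j : Mon E, ev (gpoly u j) x = 0.

(* Constructible subset of K^N of complexity <= c : a Boolean combination of
   zero sets of polynomials whose degrees sum to at most c. *)
Definition constructible (N c : nat) (S : 'rV[K]_N -> Prop) :=
  exists ps : seq {mpoly K[N]},
    (\sum_(q <- ps) (msize q).-1 <= c)%N /\
    exists B : seq (seq bool),
      forall u : 'rV[K]_N,
        S u <-> [seq q.@[fun i => u ord0 i] == 0 | q <- ps] \in B.

Definition curve_family (E : nat) (S : 'rV[K]_(Npar E) -> Prop) (g : cset) :=
  in_C3E E g /\ exists u, S u /\ cseteq g (Zpar u).

End AlgGeom.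

(* Main.v *)
Require Import Defs.
From HB Require Import structures.
From mathcomp Require Import all_boot all_algebra.
From mathcomp Require Import reals.
From mathcomp Require Import complex.
From mathcomp Require Import mpoly.
From mathcomp Require Import boolp zify ring.

(* Call a point [p] of [Z(f)] rich if many curves of degree at most [E] through [p]
   osculate to [Z(f)] at [p] to high order; flecnodes are rich.  Once [deg f] is
   large in terms of [E] alone, fewer than [c1 D^2] curves in [Z(f)] carry [c1 D]
   rich points, so the hypothesis of (a) never holds and (b) follows by listing
   the exceptional curves; the set [S] plays no role.

   Let [V] be the polynomials of degree less than [d] in each variable, where [d]
   depends only on [E], and let [n = dim V].  Let [p] be rich and nonsingular on
   [Z(f)].  A count of parameters yields a nonzero [Q] in [V] vanishing on more than
   [32 e^2 d] of the curves through [p].  Counting lengths at [p], [Q] vanishes on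
   [Z(f)] at [p] to order at least the number of these curves, hence vanishes on
   every curve through [p] by Bezout, hence on [Z(f)] at [p] to order [n].
   So at [p] the Wronskian [W] of a basis of [V] vanishes, for the powers of a vector
   field [X] tangent to [Z(f)].  As [deg W = O(D)], two applications of Bezout
   give [f | W] if too many curves carry too many rich points.  But the
   integral curves of [X] are Zariski dense in [Z(f)], so then some nonzero element
   of [V] is divisible by [f], which is absurd for large [D].

   Every form of Bezout's theorem used here comes from comparing the growth of
   Hilbert functions of ideals, with constants that are not sharp. *)

Set Implicit Arguments.
Unset Strict Implicit.
Unset Printing Implicit Defensive.

Import GRing.Theory Num.Theory.
Local Open Scope ring_scope.

(** * Unique factorization *)

(** The curves through a rich point only osculate to [Z(f)], so global information about [Z(f)] has
    to be extracted from lengths at one point. If [Q] has order [o] on a smooth germ of [Z(f)], then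
    [f], [Q] and the [N]-th power of the maximal ideal leave at most [o N] dimensions. Each of [T]
    curves on which [f] and [Q] vanish to order [N] accounts for nearly [N] of them, up to a bounded
    loss from mutual intersections; for [N] large this forces [o >= T]. The order is gained in two
    rounds because the count of parameters pays for few curves only: [d^3] coefficients against
    about [32 e^2 d] conditions per curve. That many curves give just enough contact for Bezout to
    put [Q] on all the others, and these raise the order to the size [n = d^3] of the Wronskian. *)

Section Factorial.
Variable R : comNzRingType.

Definition rdvd (a b : R) := exists c, b = c * a.

Definition prime_elt (p : R) :=
  [/\ p <> 0, ~ rdvd p 1 & forall a b, rdvd p (a * b) -> rdvd p a \/ rdvd p b].

Definition factorial_ring := forall a : R, a <> 0 ->
  exists u ps, [/\ rdvd u 1, forall p, p \in ps -> prime_elt p &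
                   a = u * \prod_(p <- ps) p].

Lemma rdvd_refl a : rdvd a a. Proof. by exists 1; rewrite mul1r. Qed.
Lemma rdvd_mull a b c : rdvd a b -> rdvd a (c * b).
Proof. by case=> d ->; exists (c * d); rewrite mulrA. Qed.
Lemma rdvd_mulr a b c : rdvd a b -> rdvd a (b * c).
Proof. by rewrite mulrC; apply: rdvd_mull. Qed.
Lemma rdvd_trans b a c : rdvd a b -> rdvd b c -> rdvd a c.
Proof. by move=> ab [d ->]; apply: rdvd_mull. Qed.
Lemma rdvd_add a b c : rdvd a b -> rdvd a c -> rdvd a (b + c).
Proof. by move=> [d ->] [e ->]; exists (d + e); rewrite mulrDl. Qed.
Lemma rdvd_0 a : rdvd a 0. Proof. by exists 0; rewrite mul0r. Qed.
Lemma rdvd_opp a b : rdvd a b -> rdvd a (- b).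
Proof. by case=> d ->; exists (- d); rewrite mulNr. Qed.
Lemma rdvd_sum a (I : Type) (r : seq I) (P : pred I) F :
  (forall i, P i -> rdvd a (F i)) -> rdvd a (\sum_(i <- r | P i) F i).
Proof.
by move=> h; apply: (big_ind (rdvd a)) => //; [exact: rdvd_0 | exact: rdvd_add].
Qed.

Lemma prime_dvd_prod p (ps : seq R) : prime_elt p ->
  rdvd p (\prod_(q <- ps) q) -> exists2 q, q \in ps & rdvd p q.
Proof.
case=> p0 p1 pP; elim: ps => [|q ps IH]; first by rewrite big_nil.
rewrite big_cons => /pP[pq|/IH[r rps pr]]; first by exists q; rewrite ?mem_head.
by exists r => //; rewrite in_cons rps orbT.
Qed.

End Factorial.

(** * Gauss's lemma *)

Section PolyFactorial.
Variable R : idomainType.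
Hypothesis Rfact : factorial_ring R.
Implicit Types (f g h : {poly R}).

Lemma rdvd_polyC (p : R) f : rdvd p%:P f <-> forall i, rdvd p f`_i.
Proof.
split=> [[c ->] i|H]; first by exists c`_i; rewrite coefMC.
pose c i := projT1 (cid (H i)).
exists (\poly_(i < size f) c i); apply/polyP=> i; rewrite coefMC coef_poly.
by case: ltnP => hi; [rewrite /c; case: (cid _) | rewrite nth_default // mul0r].
Qed.

(** In each factor take the coefficient of least index not divisible by [p]: at the sum of these
    indices, the coefficient of the product has exactly one term not divisible by [p]. *)
Lemma polyC_prime (p : R) : prime_elt p -> prime_elt p%:P.
Proof.
case=> p0 p1 pP; split.
- by move/eqP; rewrite polyC_eq0 => /eqP.
- by move/rdvd_polyC/(_ 0%N); rewrite coef1 eqxx.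
move=> f g pfg; apply: contrapT => /not_orP[nf ng].
have least (h : {poly R}) : ~ rdvd p%:P h ->
    exists i, ~ rdvd p h`_i /\ forall j, (j < i)%N -> rdvd p h`_j.
  move=> nh; have /existsNP ex : ~ forall i, rdvd p h`_i by move/rdvd_polyC.
  have exb : exists i, `[< ~ rdvd p h`_i >] by case: ex => i hi; exists i; apply/asboolP.
  exists (ex_minn exb); case: ex_minnP => i /asboolP hi min; split=> // j ji.
  by apply: contrapT => /asboolP/min; rewrite leqNgt ji.
have [i [hi mi]] := least _ nf; have [j [hj mj]] := least _ ng.
have := (rdvd_polyC p (f * g)).1 pfg (i + j)%N.
have ij : (i < (i + j).+1)%N by rewrite ltnS leq_addr.
rewrite coefM (bigD1 (Ordinal ij)) //= addKn => /rdvd_add sum.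
have : rdvd p (f`_i * g`_j).
  rewrite -[f`_i * _](addrK (\sum_(k < (i + j).+1 | k != Ordinal ij) f`_k * g`_(i + j - k))).
  apply: sum; apply/rdvd_opp/rdvd_sum => k ki.
  have [kli|kgi] := ltnP k i; first exact/rdvd_mulr/mi.
  apply/rdvd_mull/mj; rewrite ltn_subLR ?(leq_trans (ltnW _)) //; last first.
    by rewrite -ltnS; exact: ltn_ord.
  rewrite ltn_add2r ltn_neqAle kgi andbT eq_sym.
  by apply: contra ki => /eqP e; apply/eqP/val_inj.
by case/pP.
Qed.

Lemma cancel_prime_factors f (a : {poly R}) (c : R) :
    (forall p : R, prime_elt p -> ~ rdvd p%:P f) -> c != 0 ->
  rdvd f (c%:P * a) -> rdvd f a.
Proof.
move=> fprim /eqP/Rfact[u [ps [[v vu] psP ->]]] [h].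
elim: ps psP h => [|p ps IH] psP h.
  rewrite big_nil mulr1 => e; exists (v%:P * h).
  by rewrite -mulrA -e mulrA -polyCM -vu mul1r.
have pp : prime_elt p by apply: psP; rewrite mem_head.
have [pn0 pn1 pP] := polyC_prime pp.
rewrite big_cons mulrCA polyCM -mulrA => e.
have /pP[[h' eh']|/fprim] : rdvd p%:P (h * f) by rewrite -e; exact/rdvd_mulr/rdvd_refl.
  apply: (IH _ h'); first by move=> q qps; apply: psP; rewrite in_cons qps orbT.
  apply: (mulfI (introN eqP pn0)); rewrite e eh'; ring.
by [].
Qed.

(** Dividing [f] by a prime constant removes one prime from the factorization of its leading
    coefficient, so the process stops. *)
Lemma primitive_part f : f != 0 ->
  exists (c : R) g, [/\ c != 0, f = c%:P * g &
    forall p : R, prime_elt p -> ~ rdvd p%:P g].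
Proof.
move=> f0; have /eqP/Rfact[u [ps [u1 psP lf]]] : lead_coef f != 0 by rewrite lead_coef_eq0.
have [n ns] := ubnP (size ps).
elim: n ps f f0 u u1 psP lf ns => // n IH ps f f0 u u1 psP lf ns.
have [prim|/existsNP[p /not_implyP[pp /contrapT[g e]]]] :=
    pselect (forall p : R, prime_elt p -> ~ rdvd p%:P f).
  by exists 1, f; rewrite polyC1 mul1r oner_neq0.
have [pn0 pn1 pP] := pp.
have g0 : g != 0 by apply: contraNneq f0 => g0; rewrite e g0 mul0r.
have lfg : lead_coef f = lead_coef g * p by rewrite e lead_coefM lead_coefC.
have : rdvd p (u * \prod_(p <- ps) p) by rewrite -lf lfg; apply/rdvd_mull/rdvd_refl.
case/pP=> [pu|/prime_dvd_prod-/(_ pp)[q qps [w qw]]].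
  by case: pn1; exact: rdvd_trans pu u1.
have [qn0 qn1 qP] := psP q qps.
have w1 : rdvd w 1.
  have /qP[] : rdvd q (w * p) by rewrite -qw; exact: rdvd_refl.
    move=> [z ez]; case: pn1; exists z; apply: (mulfI (introN eqP qn0)).
    by rewrite mulr1 mulrA [q * z]mulrC -ez.
  move=> [z ez]; exists z; apply: (mulfI (introN eqP pn0)).
  by rewrite mulr1 {1}ez qw mulrA mulrC mulrA.
have [||||c [g' [c0 eg prim]]] := IH (rem q ps) g g0 (u * w).
- by case: u1 => a ea; case: w1 => b eb; exists (a * b); rewrite mulrACA -ea -eb mulr1.
- by move=> r /mem_rem; exact: psP.
- apply: (mulIf (introN eqP pn0)); rewrite -lfg lf (perm_big _ (perm_to_rem qps)) big_cons /=.
  by rewrite {1}qw; ring.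
- by rewrite size_rem //; case: (ps) qps ns.
exists (p * c), g'; split=> //; first by rewrite mulf_neq0 //; apply/eqP.
by rewrite e eg polyCM mulrC mulrA.
Qed.

(** Let [d] be the gcd of [f] and [a] up to constants. If [d] is constant, [f] divides a constant
    multiple of [b]. Otherwise the primitive part of [d] divides [f]; indecomposability makes the
    cofactor constant, and it is a unit because no prime constant divides [f]. Primitivity lets all
    constants be cancelled. *)
Lemma primitive_indecomposable_prime f : (1 < size f)%N ->
    (forall p : R, prime_elt p -> ~ rdvd p%:P f) ->
    (forall g h, f = g * h -> (size g <= 1)%N \/ (size h <= 1)%N) ->
  prime_elt f.
Proof.
move=> f1 fprim find; have f0 : f != 0 by rewrite -size_poly_gt0 ltnW.
split; first exact/eqP.
  case=> c /(congr1 (fun p : {poly R} => size p)); rewrite size_poly1 => e.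
  have c0 : c != 0 by apply/eqP=> c0; move: e; rewrite c0 mul0r size_poly0.
  move: e; rewrite size_mul // => e; move: c0 f1 e; rewrite -size_poly_gt0.
  by case: (size c) => [|m] //; case: (size f) => [|[|n]] // _ _; rewrite addnS /= addnS.
move=> a b [k fk]; set d := gcdp f a.
have [d1|d1] := leqP (size d) 1.
  right; have co : coprimep f a.
    by rewrite /coprimep eqn_leq d1 size_poly_gt0 gcdp_eq0 negb_and f0.
  have : dvdp f b.
    rewrite -(Pdiv.CommonIdomain.Gauss_dvdpr b co) fk; exact: Pdiv.CommonIdomain.dvdp_mulIr.
  case/Pdiv.WeakIdomain.dvdpP => -[c q] /= c0 e.
  by apply: (cancel_prime_factors fprim c0); exists q; rewrite mul_polyC.
left; have /Pdiv.WeakIdomain.dvdpP[[c q] /= c0 e] := Pdiv.CommonIdomain.dvdp_gcdl f a.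
have d0 : d != 0 by rewrite -size_poly_gt0 ltnW.
have q0 : q != 0.
  apply/eqP=> q0; move: e; rewrite q0 mul0r -mul_polyC => /eqP.
  by rewrite mulf_eq0 polyC_eq0 (negPf c0) (negPf f0).
have [c' [q' [c'0 eq' q'prim]]] := primitive_part q0.
have [c'' [d' [c''0 ed' d'prim]]] := primitive_part d0.
have mprim (p : R) : prime_elt p -> ~ rdvd p%:P (q' * d').
  by move=> pp; have [_ _ pP] := polyC_prime pp => /pP[/q'prim|/d'prim]; apply.
have e' : c%:P * f = (c' * c'')%:P * (q' * d').
  by rewrite mul_polyC e -/d eq' ed' polyCM; ring.
have [k1 ek1] : rdvd f (q' * d').
  apply: (cancel_prime_factors fprim (mulf_neq0 c'0 c''0)).
  by rewrite -e'; exact/rdvd_mull/rdvd_refl.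
have [k2 ek2] : rdvd (q' * d') f.
  apply: (cancel_prime_factors mprim c0).
  by rewrite e'; exact/rdvd_mull/rdvd_refl.
have sd : size d = size d' by rewrite ed' size_Cmul.
have [sk|] : (size (k2 * q')%R <= 1)%N \/ (size d' <= 1)%N.
  by apply: find; rewrite -mulrA.
- have fd' : f = (k2 * q') * d' by rewrite -mulrA.
  move: sk; rewrite leq_eqVlt ltnS leqn0 size_poly_eq0.
  case/orP=> [/size_poly1P[w w0 ew]|/eqP ew]; last first.
    by move: f0; rewrite fd' ew mul0r eqxx.
  have [u [ps [[v vu] psP ewp]]] : exists u ps, [/\ rdvd u 1,
     forall p, p \in ps -> prime_elt p & w = u * \prod_(p <- ps) p].
    exact/Rfact/eqP.
  have ps0 : ps = [::].
    case: ps psP ewp => // p ps psP ewp.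
    case: (fprim p); first by apply: psP; rewrite mem_head.
    rewrite fd' ew ewp big_cons mulrCA polyCM; exact/rdvd_mulr/rdvd_mulr/rdvd_refl.
  have /Pdiv.WeakIdomain.dvdpP[[c2 q2] /= c20 e2] := Pdiv.CommonIdomain.dvdp_gcdr f a.
  apply: (cancel_prime_factors fprim c20); rewrite mul_polyC e2 -/d ed'.
  exists (q2 * c''%:P * v%:P); rewrite fd' ew ewp ps0 big_nil mulr1.
  have vuP : 1 = v%:P * u%:P :> {poly R} by rewrite -polyCM -vu.
  by rewrite -[LHS]mulr1 vuP; ring.
- by rewrite -sd leqNgt d1.
Qed.

(** A polynomial that does not split into nonconstant factors is a constant times a primitive one,
    which is prime if nonconstant and a unit otherwise. *)
Lemma poly_factorial : factorial_ring {poly R}.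
Proof.
move=> f; have [n] := ubnP (size f); elim: n f => // n IH f sf /eqP f0.
have [[g [h [e g1 h1]]]|ind] :=
    pselect (exists g h, [/\ f = g * h, (1 < size g)%N & (1 < size h)%N]).
  have g0 : g != 0 by rewrite -size_poly_gt0 ltnW.
  have h0 : h != 0 by rewrite -size_poly_gt0 ltnW.
  have sfg : size f = (size g + size h).-1 by rewrite e size_mul.
  have [sg sh] : (size g < n)%N /\ (size h < n)%N.
    by move: sf g1 h1; rewrite sfg; move: (size g) (size h) => a b; lia.
  have [|u [ps [[v vu] psP eg]]] := IH g sg; first exact/eqP.
  have [|u' [ps' [[v' vu'] ps'P eh]]] := IH h sh; first exact/eqP.
  exists (u * u'), (ps ++ ps'); split.
  - by exists (v * v'); rewrite mulrACA -vu -vu' mulr1.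
  - by move=> p; rewrite mem_cat => /orP[/psP|/ps'P].
  - by rewrite big_cat e eg eh mulrACA.
have [c [g [c0 e prim]]] := primitive_part f0.
have [u [ps [[v vu] psP ec]]] := Rfact (elimN eqP c0).
have g0 : g != 0 by apply: contraNneq f0 => g0; rewrite e g0 mulr0.
have main ps' w : rdvd w 1 -> (forall p, p \in ps' -> prime_elt p) ->
    g = w * \prod_(p <- ps') p ->
  exists u ps, [/\ rdvd u 1, forall p, p \in ps -> prime_elt p &
                   f = u * \prod_(p <- ps) p].
  move=> [w' ww'] ps'P eg; exists (u%:P * w), (map polyC ps ++ ps'); split.
  - by exists (v%:P * w'); rewrite mulrACA -ww' -polyCM -vu mulr1.
  - move=> p; rewrite mem_cat => /orP[/mapP[q qps ->]|/ps'P//].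
    exact/polyC_prime/psP.
  - rewrite big_cat big_map /= e ec eg polyCM rmorph_prod /=; ring.
have [g1|g1] := leqP (size g) 1; last first.
  apply: (main [:: g] 1); first exact: rdvd_refl.
    move=> p; rewrite inE => /eqP->; apply: primitive_indecomposable_prime => // a b eab.
    apply: contrapT => /not_orP[/negP + /negP]; rewrite -!ltnNge => a1 b1.
    apply: ind; exists (c%:P * a), b; split=> //; first by rewrite e eab mulrA.
    by rewrite size_Cmul.
  by rewrite big_seq1 mul1r.
have /size_poly1P[w w0 ew] : size g == 1%N by rewrite eqn_leq g1 size_poly_gt0.
apply: (main [::] g) => //; last by rewrite big_nil mulr1.
have [z [qs [[y yz] qsP ewz]]] := Rfact (elimN eqP w0).
case: qs qsP ewz => [|q qs] qsP ewz.
  by exists y%:P; rewrite ew ewz big_nil mulr1 -polyCM -yz.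
case: (prim q); first by apply: qsP; rewrite mem_head.
by rewrite ew ewz big_cons mulrCA polyCM; exact/rdvd_mulr/rdvd_refl.
Qed.

End PolyFactorial.

Lemma factorial_transport (A B : comNzRingType) (phi : A -> B) (psi : B -> A) :
    {morph phi : x y / x * y} -> phi 1 = 1 -> phi 0 = 0 ->
  cancel phi psi -> cancel psi phi -> factorial_ring B -> factorial_ring A.
Proof.
move=> phiM phi1 phi0 pK qK Bf a a0.
have psiM : {morph psi : x y / x * y} by move=> x y; rewrite -(pK (_ * _)) phiM !qK.
have psi1 : psi 1 = 1 by rewrite -phi1 pK.
have dvdE x y : rdvd (psi x) y <-> rdvd x (phi y).
  split=> -[c e]; first by exists (phi c); rewrite e phiM qK.
  by exists (psi c); rewrite -psiM -e pK.
have [|u [ps [u1 psP e]]] := Bf (phi a).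
  by move=> e; apply: a0; rewrite -(pK a) e -phi0 pK.
exists (psi u), (map psi ps); split.
- by apply/dvdE; rewrite phi1.
- move=> p /mapP[q /psP[q0 q1 qP] ->]; split.
  + by move=> e0; apply: q0; rewrite -(qK q) e0 phi0.
  + by move/dvdE; rewrite phi1.
  + by move=> x y /dvdE; rewrite phiM => /qP[]/dvdE; [left|right].
- rewrite big_map -[LHS]pK e psiM; congr (_ * _); elim: (ps) => [|p r IH].
    by rewrite !big_nil psi1.
  by rewrite !big_cons psiM IH.
Qed.

(** * Multivariate polynomials, one variable at a time *)

Section MpolyFactorial.
Variable K : fieldType.

Definition of_uni (n : nat) (p : {poly {mpoly K[n]}}) : {mpoly K[n.+1]} :=
  \sum_(i < size p) mwiden p`_i * 'X_ord_max ^+ i.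

Lemma of_uniE n d (p : {poly {mpoly K[n]}}) : (size p <= d)%N ->
  of_uni p = \sum_(i < d) mwiden p`_i * 'X_ord_max ^+ i.
Proof.
move=> pd; rewrite /of_uni (big_ord_widen _ (fun i => mwiden p`_i * 'X_ord_max ^+ i) pd).
rewrite big_mkcond; apply: eq_bigr => i _; case: ltnP => // h.
by rewrite nth_default // mwiden0 mul0r.
Qed.

Lemma of_uniD n (p q : {poly {mpoly K[n]}}) : of_uni (p + q) = of_uni p + of_uni q.
Proof.
pose d := maxn (size p) (size q).
rewrite (@of_uniE _ d (p + q)) ?size_polyD // (@of_uniE _ d p) ?leq_maxl //.
rewrite (@of_uniE _ d q) ?leq_maxr // -big_split /=; apply: eq_bigr => i _.
by rewrite coefD mwidenD mulrDl.
Qed.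

Lemma of_uni0 n : of_uni (0 : {poly {mpoly K[n]}}) = 0.
Proof. by rewrite /of_uni size_poly0 big_ord0. Qed.

Lemma of_uniZXn n (c : {mpoly K[n]}) d : of_uni (c *: 'X^d) = mwiden c * 'X_ord_max ^+ d.
Proof.
rewrite (@of_uniE _ d.+1); last first.
  by rewrite (leq_trans (size_scale_leq _ _)) // size_polyXn.
rewrite big_ord_recr big1 /=; last first.
  by move=> i _; rewrite coefZ coefXn ltn_eqF // mulr0 mwiden0 mul0r.
by rewrite add0r coefZ coefXn eqxx mulr1.
Qed.

Lemma muniX n (m : 'X_{1..n.+1}) : @muni n K 'X_[m] =
  'X_[[multinom (m (widen_ord (leqnSn n) i)) | i < n]] *: 'X^(m ord_max).
Proof. by rewrite muniE msuppX big_seq1 mcoeffX eqxx scale1r. Qed.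

Lemma mwidenXmul n (m : 'X_{1..n.+1}) :
  mwiden 'X_[[multinom (m (widen_ord (leqnSn n) i)) | i < n]] * 'X_ord_max ^+ (m ord_max)
  = 'X_[m] :> {mpoly K[n.+1]}.
Proof.
rewrite mwidenX mpolyXn -mpolyXD; congr 'X_[_]; apply/mnmP => i.
rewrite mnmDE mulmnE mnm1E; have [e|ne] := eqVneq ord_max i.
  by rewrite -e mnmwiden_ordmax mul1n.
have iN : (i < n)%N.
  by rewrite ltn_neqAle -ltnS ltn_ord andbT; apply: contra ne => /eqP e; apply/eqP/val_inj.
have -> : i = widen_ord (leqnSn n) (Ordinal iN) by apply/val_inj.
by rewrite mnmwiden_widen mnmE mul0n addn0.
Qed.

Lemma muniK n : cancel (@muni n K) (@of_uni n).
Proof.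
elim/mpolyind => [|c m p _ _ IH]; first by rewrite muni0 of_uni0.
rewrite muniD of_uniD; congr (_ + _); last exact: IH.
rewrite muniZ muniX scalerA of_uniZXn mwidenM.
by rewrite -mulrA mwidenXmul mwidenC mul_mpolyC.
Qed.

Lemma muni_mwiden n (c : {mpoly K[n]}) : muni (mwiden c) = c%:P.
Proof.
elim/mpolyind: c => [|c m p _ _ IH]; first by rewrite mwiden0 muni0.
rewrite mwidenD muniD polyCD; congr (_ + _); last exact: IH.
rewrite mwidenZ muniZ mwidenX muniX.
rewrite mnmwiden_ordmax expr0 alg_polyC -mul_polyC -polyCM mul_mpolyC.
by congr (_ *: 'X_[_])%:P; apply/mnmP => i; rewrite mnmE mnmwiden_widen.
Qed.

Lemma muni_Xmax n : muni ('X_ord_max : {mpoly K[n.+1]}) = 'X.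
Proof.
rewrite muniX mnm1E eqxx.
have -> : [multinom (U_(ord_max)%MM (widen_ord (leqnSn n) j)) | j < n] = 0%MM.
  apply/mnmP=> j; rewrite mnmE mnm0E mnm1E; case: eqP => // /(congr1 val) /= e.
  by have := ltn_ord j; rewrite -e ltnn.
by rewrite mpolyX0 scale1r.
Qed.

Lemma of_uniK n : cancel (@of_uni n) (@muni n K).
Proof.
move=> p; rewrite /of_uni (big_morph _ (@muniD n K) (@muni0 n K)) -[RHS]coefK poly_def.
apply: eq_bigr => i _; rewrite muniM muni_mwiden mul_polyC; congr (_ *: _).
by elim: (nat_of_ord i) => [|k IH]; rewrite ?expr0 ?muni1 // !exprS muniM IH muni_Xmax.
Qed.

Lemma mpoly_factorial n : factorial_ring {mpoly K[n]}.
Proof.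
elim: n => [|n IH]; last first.
  exact: (factorial_transport (@muniM n K) (@muni1 n K) (@muni0 n K) (@muniK n) (@of_uniK n)
  (poly_factorial IH)).
move=> a /eqP a0; exists a, [::]; split=> //; last by rewrite big_nil mulr1.
have ca := nvar0_mpolyC a; exists (a@_0)^-1%:MP; rewrite [X in _ * X]ca -mpolyCM mulVf //.
by apply: contra a0 => /eqP e; rewrite ca e.
Qed.

Lemma unit_msize n (u : {mpoly K[n]}) : rdvd u 1 -> (msize u <= 1)%N.
Proof.
case=> v e; have u0 : u != 0 by apply/eqP=> u0; move/eqP: e; rewrite u0 mulr0 oner_eq0.
have v0 : v != 0 by apply/eqP=> v0; move/eqP: e; rewrite v0 mul0r oner_eq0.
have := msizeM v0 u0; rewrite -e msize1.
move: u0 v0; rewrite -!msize_poly_eq0; case: (msize u) => // -[|k] // _.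
by case: (msize v) => // l _; lia.
Qed.

Lemma rdvd_msize n (f g : {mpoly K[n]}) : g != 0 -> rdvd f g -> (msize f <= msize g)%N.
Proof.
move=> g0 [h e]; have /andP[h0 f0] : (h != 0) && (f != 0) by move: g0; rewrite e mulf_eq0 negb_or.
rewrite e msizeM //; move: h0; rewrite -msize_poly_eq0.
by case: (msize h) => // k _; rewrite addSn /= leq_addl.
Qed.

Lemma mirreducible_prime (f : {mpoly K[3]}) : mirreducible f -> prime_elt f.
Proof.
case=> f1 irr; have /eqP f0 : f != 0 by rewrite -msize_poly_eq0 -lt0n ltnW.
have [u [ps [u1 psP e]]] := mpoly_factorial f0.
case: ps psP e => [|p ps] psP e.
  by move: f1; rewrite e big_nil mulr1 ltnNge unit_msize.
have pp : prime_elt p by apply: psP; rewrite mem_head.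
have [pn0 pn1 pP] := pp.
have [||] := irr p (u * \prod_(q <- ps) q); first by rewrite e big_cons; ring.
  move/msize1_polyC => ep; case: pn1; exists (p@_0)^-1%:MP.
  rewrite [X in _ * X]ep -mpolyCM mulVf //.
  by apply: contra_not_neq pn0 => e0; rewrite ep e0.
move/msize1_polyC; set c := (_@_0) => ec.
have fE : f = c%:MP * p by rewrite e big_cons mulrCA ec mulrC.
have c0 : c != 0 by apply/eqP=> c0; apply: f0; rewrite fE c0 mpolyC0 mul0r.
have cV : c^-1%:MP * c%:MP = 1 :> {mpoly K[3]} by rewrite -mpolyCM mulVf.
rewrite fE; split.
- by move/eqP; rewrite mulf_eq0 mpolyC_eq0 (negPf c0) => /eqP.
- by case=> d ed; apply: pn1; exists (d * c%:MP); rewrite -mulrA.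
move=> a b /(rdvd_trans (rdvd_mull c%:MP (rdvd_refl p)))/pP[] [d ->]; [left|right];
  by exists (d * c^-1%:MP); rewrite -mulrA [c^-1%:MP * _]mulrA cV mul1r.
Qed.

End MpolyFactorial.

(** * Dimension of quotients *)

Section Codimension.
Variables (K : fieldType) (V : lmodType K).
Implicit Types (A B C : V -> Prop) (N M : nat).

Definition subsp B := [/\ B 0, forall x y, B x -> B y -> B (x + y) &
  forall c x, B x -> B (c *: x)].

(* [dim_ge A B N] and [dim_le A B N] bound the dimension of [(A + B) / B]
   for subspaces [A] and [B]; in [dim_le] the spanning family need not lie in [A]. *)
Definition dim_ge A B N := exists s : 'I_N -> V, (forall i, A (s i)) /\
  forall c : 'I_N -> K, B (\sum_i c i *: s i) -> forall i, c i = 0.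

Definition dim_le A B N := exists s : 'I_N -> V,
  forall a, A a -> exists c : 'I_N -> K, B (a - \sum_i c i *: s i).

Lemma subspN B x : subsp B -> B x -> B (- x).
Proof. by case=> _ _ BZ Bx; rewrite -scaleN1r; apply: BZ. Qed.
Lemma subspB B x y : subsp B -> B x -> B y -> B (x - y).
Proof. by move=> sB Bx By; case: (sB) => _ BD _; apply: BD => //; exact: subspN. Qed.
Lemma subsp_sum B (I : Type) (r : seq I) (P : pred I) F : subsp B ->
  (forall i, P i -> B (F i)) -> B (\sum_(i <- r | P i) F i).
Proof. by case=> B0 BD _ BF; apply: (big_ind B). Qed.

Lemma dim_ge_leq A B N M : subsp B -> dim_ge A B N -> dim_le A B M -> (N <= M)%N.
Proof.
move=> sB [s [sA sfree]] [s' span]; rewrite leqNgt; apply/negP => MN.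
pose c i := projT1 (cid (span _ (sA i))).
have cP i : B (s i - \sum_j c i j *: s' j) by rewrite /c; case: (cid _).
pose C := \matrix_(i < N, j < M) c i j.
have kC : kermx C != 0.
  by rewrite kermx_eq0 /row_free ltn_eqF // (leq_ltn_trans (rank_leq_col _) MN).
case/rowV0Pn: kC => v /sub_kermxP vC v0.
case/eqP: v0; apply/rowP => i; rewrite mxE.
apply: (sfree (fun i => v 0 i)) => {i}.
have -> : \sum_i v 0 i *: s i = \sum_i v 0 i *: (s i - \sum_j c i j *: s' j).
  under [RHS]eq_bigr do rewrite scalerBr scaler_sumr.
  rewrite sumrB exchange_big /= [X in _ - X]big1 ?subr0 // => j _.
  under eq_bigr do rewrite scalerA.
  rewrite -scaler_suml; move/rowP/(_ j): vC; rewrite !mxE => e.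
  have -> : \sum_i v 0 i * c i j = 0 by rewrite -[RHS]e; apply: eq_bigr => i _; rewrite mxE.
  by rewrite scale0r.
by apply: subsp_sum => // i _; case: sB => _ _; apply.
Qed.

Lemma dim_ge_fin (I : finType) (s : I -> V) A B : (forall i, A (s i)) ->
    (forall c : I -> K, B (\sum_i c i *: s i) -> forall i, c i = 0) ->
  dim_ge A B #|I|.
Proof.
move=> sA sfree; exists (fun i => s (enum_val i)); split=> // c Bc i.
rewrite -[ i ]enum_valK; apply: (sfree (fun j => c (enum_rank j))).
rewrite (reindex (fun j : 'I_#|I| => enum_val j)) /=; last by apply: onW_bij; exact: enum_val_bij.
by under eq_bigr do rewrite enum_valK.
Qed.

Lemma dim_le_fin (I : finType) (s : I -> V) A B :
    (forall a, A a -> exists c : I -> K, B (a - \sum_i c i *: s i)) ->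
  dim_le A B #|I|.
Proof.
move=> span; exists (fun i => s (enum_val i)) => a /span[c Bc].
exists (fun i => c (enum_val i)).
by rewrite (reindex (fun j : 'I_#|I| => enum_val j)) /= in Bc; last by apply: onW_bij; exact: enum_val_bij.
Qed.

Lemma dim_geS A A' B B' N N' : (N' <= N)%N -> (forall x, A x -> A' x) ->
  (forall x, B' x -> B x) -> dim_ge A B N -> dim_ge A' B' N'.
Proof.
move=> NN AA BB [s [sA sfree]].
exists (fun i => s (widen_ord NN i)); split=> [i|c Bc i]; first exact/AA.
pose c' (i : 'I_N) := if insub (val i) is Some j then c j else 0.
have c'w (j : 'I_N') : c' (widen_ord NN j) = c j by rewrite /c' -[val (widen_ord NN j)]/(val j) valK.
rewrite -c'w; apply: sfree; suff -> : \sum_i c' i *: s i = \sum_j c j *: s (widen_ord NN j) by exact: BB.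
pose F n := if insub n is Some k then c' k *: s k else 0.
transitivity (\sum_(k < N) F k).
  by apply: eq_bigr => k _; rewrite /F valK.
rewrite -(big_mkord xpredT F) (big_cat_nat (leq0n _) NN) //= !big_mkord [X in _ + X]big_nat_cond [X in _ + X]big1 ?addr0.
  apply: eq_bigr => j _; rewrite /F -c'w.
  by rewrite -[nat_of_ord j]/(val (widen_ord NN j)) valK.
move=> k /andP[/andP[k1 k2] _]; rewrite /F; case: insubP => // u _ uk.
by rewrite /c' insubF ?scale0r // uk ltnNge k1.
Qed.

Lemma dim_leS A A' B B' N N' : (N' <= N)%N -> (forall x, A x -> A' x) ->
  (forall x, B' x -> B x) -> dim_le A' B' N' -> dim_le A B N.
Proof.
move=> NN AA BB [s span].
exists (fun i => if insub (val i) is Some j then s j else 0) => a /AA/span[c Bc].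
exists (fun i => if insub (val i) is Some j then c j else 0).
suff -> : \sum_(i < N) (if insub (val i) is Some j then c j else 0) *:
     (if insub (val i) is Some j then s j else 0) = \sum_j c j *: s j by exact: BB.
pose F n := if (insub n : option 'I_N') is Some k then c k *: s k else 0.
transitivity (\sum_(k < N) F k).
  by apply: eq_bigr => k _; rewrite /F; case: insubP => // _; rewrite scaler0.
rewrite -(big_mkord xpredT F) (big_cat_nat (leq0n _) NN) //= !big_mkord [X in _ + X]big_nat_cond [X in _ + X]big1 ?addr0.
  by apply: eq_bigr => j _; rewrite /F valK.
by move=> k /andP[/andP[k1 k2] _]; rewrite /F insubF // ltnNge k1.
Qed.

Lemma dim_ge0 A B : dim_ge A B 0.
Proof. by exists (fun=> 0); split=> [[]|c _ []]. Qed.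

(** Dimensions add along a filtration: a relation modulo both [B] and [C] first kills the
    coefficients of the family free modulo [B], then those of the family inside [B]. *)
Lemma dim_ge_cat A A' B C n m : (forall x, A' x -> A x /\ B x) -> subsp B ->
  dim_ge A B n -> dim_ge A' C m -> dim_ge A (fun x => B x /\ C x) (n + m).
Proof.
move=> A'P sB [s [sA sfree]] [s' [sA' sfree']].
exists (fun i => match split i with inl j => s j | inr j => s' j end); split.
  by move=> i; case: split => j //; case: (A'P _ (sA' j)).
move=> c; rewrite big_split_ord /=.
under eq_bigr do rewrite (unsplitK (inl _ _)).
under [X in _ + X]eq_bigr do rewrite (unsplitK (inr _ _)).
move=> [Bc Cc].
have c1 i : c (lshift m i) = 0.
  apply: (sfree (fun i => c (lshift m i))).
  rewrite -[\sum_i _](addrK (\sum_(i < m) c (rshift n i) *: s' i)).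
  apply: subspB => //; apply: subsp_sum => // j _.
  by case: sB => _ _; apply; case: (A'P _ (sA' j)).
have c2 i : c (rshift n i) = 0.
  apply: (sfree' (fun i => c (rshift n i))).
  by move: Cc; rewrite big1 ?add0r // => j _; rewrite c1 scale0r.
by move=> i; rewrite -[ i ]splitK; case: split.
Qed.

Lemma dim_le_trans A B C n m : subsp C ->
  dim_le A B n -> dim_le B C m -> dim_le A C (n + m).
Proof.
move=> sC [s span] [s' span'].
exists (fun i => match split i with inl j => s j | inr j => s' j end) => a Aa.
have [c /span'[c' Cc]] := span a Aa.
exists (fun i => match split i with inl j => c j | inr j => c' j end).
rewrite big_split_ord /=.
under eq_bigr do rewrite (unsplitK (inl _ _)).
under [X in _ - (_ + X)]eq_bigr do rewrite (unsplitK (inr _ _)).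
by rewrite opprD addrA.
Qed.

Lemma dim_dichotomy A B N : subsp A -> subsp B -> ~ dim_ge A B N.+1 -> dim_le A B N.
Proof.
move=> sA sB nge.
have [M MN [geM ngeM]] : exists2 M, (M <= N)%N & dim_ge A B M /\ ~ dim_ge A B M.+1.
  elim: N nge => [|N IH] nge; first by exists 0%N => //; split=> //; exact: dim_ge0.
  have [ge|/IH[M MN H]] := pselect (dim_ge A B N.+1); first by exists N.+1.
  by exists M => //; exact: leqW.
apply: (@dim_leS A A B B N M) => //; case: geM => s [As sfree]; exists s => a Aa.
apply: contrapT => na; apply: ngeM.
exists (fun i => if unlift ord_max i is Some j then s j else a); split.
  by move=> i; case: unlift => [j|].
move=> c; rewrite big_ord_recr /= unlift_none.
have wl i : widen_ord (leqnSn M) i = lift ord_max i.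
  by apply: val_inj; rewrite [RHS]lift_max.
have E : \sum_(i < M) c (widen_ord (leqnSn M) i) *: (if unlift ord_max (widen_ord (leqnSn M) i) is Some j then s j else a)
   = \sum_(i < M) c (widen_ord (leqnSn M) i) *: s i.
  by apply: eq_bigr => i _; rewrite wl liftK.
rewrite E => Bc; have cm : c ord_max = 0.
  apply: contrapT => /eqP cm; apply: na.
  exists (fun i => - (c ord_max)^-1 * c (widen_ord (leqnSn M) i)).
  have -> : a - \sum_i - (c ord_max)^-1 * c (widen_ord (leqnSn M) i) *: s i =
     (c ord_max)^-1 *: (\sum_(i < M) c (widen_ord (leqnSn M) i) *: s i + c ord_max *: a).
    rewrite scalerDr scalerA mulVf // scale1r addrC -sumrN scaler_sumr; congr (_ + _).
    by apply: eq_bigr => i _; rewrite mulNr scaleNr opprK scalerA.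
  by case: sB => _ _; apply.
move: Bc; rewrite cm scale0r addr0 => /(sfree (fun i => c (widen_ord _ i))) cw i.
have [j ->|->//] := unliftP ord_max i.
by rewrite -wl cw.
Qed.

Definition subsum A B x := exists a b, [/\ A a, B b & x = a + b].

Lemma subsp_sum2 A B : subsp A -> subsp B -> subsp (subsum A B).
Proof.
move=> [A0 AD AZ] [B0 BD BZ]; split.
- by exists 0, 0; rewrite addr0.
- move=> _ _ [a [b [Aa Bb ->]]] [a' [b' [Aa' Bb' ->]]].
  by exists (a + a'), (b + b'); split; [exact: AD|exact: BD|rewrite addrACA].
- by move=> c _ [a [b [Aa Bb ->]]]; exists (c *: a), (c *: b); rewrite scalerDr; split; [exact: AZ|exact: BZ|].
Qed.

Lemma subsumr A B x : subsp A -> B x -> subsum A B x.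
Proof. by case=> A0 _ _ Bx; exists 0, x; rewrite add0r. Qed.
Lemma subsuml A B x : subsp B -> A x -> subsum A B x.
Proof. by case=> B0 _ _ Ax; exists x, 0; rewrite addr0. Qed.

(** What [X] has modulo [A] but not modulo [A + B] comes from [B]. *)
Lemma dim_ge_quot X A B a e : subsp A -> subsp B ->
  dim_ge X A a -> dim_le X (subsum A B) e -> dim_ge B A (a - e).
Proof.
move=> sA sB geA leAB; apply: contrapT => nge.
have lt : (0 < a - e)%N by case: (a - e)%N nge => // -[]; exact: dim_ge0.
have := @dim_dichotomy B A (a - e).-1 sB sA; rewrite prednK // => /(_ nge)[s span].
have le2 : dim_le (subsum A B) A (a - e).-1.
  exists s => _ [x [y [Ax /span[c Ac] ->]]]; exists c.
  by rewrite -addrA; case: sA => _ AD _; apply: AD.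
have := dim_ge_leq sA geA (dim_le_trans sA leAB le2).
by move: lt; lia.
Qed.

End Codimension.

Lemma dim_ge_map (K : fieldType) (V W : lmodType K) (T : V -> W) A A' B B' N :
    (forall M (c : 'I_M -> K) (s : 'I_M -> V), T (\sum_i c i *: s i) = \sum_i c i *: T (s i)) ->
    (forall x, A x -> A' (T x)) -> subsp A -> (forall x, A x -> B' (T x) -> B x) ->
  dim_ge A B N -> dim_ge A' B' N.
Proof.
move=> Tlin TA sA TB [s [sAs sfree]]; exists (fun i => T (s i)); split=> [i|c Bc].
  exact: TA.
apply: sfree; apply: TB; last by rewrite Tlin.
by apply: subsp_sum => // i _; case: sA => _ _; apply.
Qed.

(** * Hilbert functions *)

Section Boxes.
Variable K : fieldType.
Local Notation P := {mpoly K[3]}.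
Implicit Types (f g Q : P) (I J : P -> Prop).

Definition ideal J := [/\ J 0, forall x y, J x -> J y -> J (x + y) &
  forall a x, J x -> J (a * x)].

Definition prime_ideal I := [/\ ideal I, ~ I 1 & forall a b, I (a * b) -> I a \/ I b].

Lemma ideal_subsp J : ideal J -> subsp J.
Proof. by case=> J0 JD JM; split=> // c x Jx; rewrite -mul_mpolyC; apply: JM. Qed.

Lemma idealMr J a x : ideal J -> J x -> J (x * a).
Proof. by case=> _ _ JM Jx; rewrite mulrC; apply: JM. Qed.

Lemma ideal_sum J (I : Type) (r : seq I) (p : pred I) F : ideal J ->
  (forall i, p i -> J (F i)) -> J (\sum_(i <- r | p i) F i).
Proof. by case=> J0 JD _ JF; apply: (big_ind J). Qed.

Lemma ideal_rdvd Q : ideal (rdvd Q).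
Proof. by split; [exact: rdvd_0|move=> x y; exact: rdvd_add|move=> a x; exact: rdvd_mull]. Qed.

Lemma ideal_eq0 : ideal (fun x : P => x = 0).
Proof. by split=> [//|x y -> ->|a x ->]; rewrite ?addr0 ?mulr0. Qed.

Lemma ideal_subsum I J : ideal I -> ideal J -> ideal (subsum I J).
Proof.
move=> iI iJ; have [s0 sD _] := subsp_sum2 (ideal_subsp iI) (ideal_subsp iJ).
split=> // a _ [x [y [Ix Jy ->]]]; exists (a * x), (a * y); rewrite mulrDr.
by case: iI iJ => [_ _ IM] [_ _ JM]; split; [exact: IM|exact: JM|].
Qed.

(* Polynomials of degree less than [e] in each variable.  Their dimension is
   exactly [e ^ 3], which is why boxes replace total degree throughout. *)
Definition box e g := forall m, m \in msupp g -> forall i, (m i < e)%N.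

Lemma box_subsp e : subsp (box e).
Proof.
split=> [m|x y bx by_ m|c x bx m]; first by rewrite msupp0.
  by move/msuppD_le; rewrite mem_cat => /orP[/bx|/by_].
by move/msuppZ_le/bx.
Qed.

Lemma box_leq e e' g : (e <= e')%N -> box e g -> box e' g.
Proof. by move=> le bg m /bg h i; exact: leq_trans (h i) le. Qed.

Lemma boxM a b f g : box a.+1 f -> box b g -> box (a + b) (f * g).
Proof.
move=> bf bg m /msuppM_le/allpairsP[[m1 m2] /= [/bf h1 /bg h2 ->]] i.
by rewrite mnmDE; have := h1 i; have := h2 i; lia.
Qed.

Lemma box_msize e g : (msize g <= e)%N -> box e g.
Proof.
move=> ge m /msize_mdeg_lt h i; apply: leq_trans ge; apply: leq_ltn_trans h.
by rewrite mdegE (bigD1 i) //= leq_addr.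
Qed.

Lemma boxC e c : (0 < e)%N -> box e (c%:MP : P).
Proof. by move=> e0; apply: box_msize; rewrite msizeC (leq_trans (leq_b1 _)). Qed.

Lemma boxX i : box 2 ('X_i : P).
Proof. by apply: box_msize; rewrite msizeX mdeg1. Qed.

Definition ffmon e (w : {ffun 'I_3 -> 'I_e}) : 'X_{1..3} := [multinom val (w i) | i < 3].

Lemma ffmon_inj e : injective (@ffmon e).
Proof.
move=> w w' /mnmP E; apply/ffunP => i; apply: val_inj.
by have := E i; rewrite !mnmE.
Qed.

Lemma box_ffmon e (w : {ffun 'I_3 -> 'I_e}) : box e ('X_[ffmon w] : P).
Proof. by move=> m; rewrite msuppX inE => /eqP-> i; rewrite mnmE; exact: ltn_ord. Qed.

Lemma boxE e g : box e g -> g = \sum_(w : {ffun 'I_3 -> 'I_e}) g@_(ffmon w) *: 'X_[ffmon w].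
Proof.
move=> bg; apply/mpolyP => m; rewrite raddf_sum /=.
have [mg|] := boolP (m \in msupp g); last first.
  rewrite mcoeff_msupp negbK => /eqP g0; rewrite g0 big1 // => w _.
  by rewrite mcoeffZ mcoeffX; case: eqP => [->|]; rewrite ?mulr0 // g0 mul0r.
pose w0 : {ffun 'I_3 -> 'I_e} := [ffun i => Ordinal (bg m mg i)].
have w0m : ffmon w0 = m by apply/mnmP => i; rewrite mnmE ffunE.
rewrite (bigD1 w0) //= mcoeffZ mcoeffX w0m eqxx mulr1 big1 ?addr0 // => w ww0.
rewrite mcoeffZ mcoeffX -w0m; case: eqP => [/ffmon_inj e1|]; last by rewrite mulr0.
by rewrite e1 eqxx in ww0.
Qed.

Lemma card_ffmon e : #|{: {ffun 'I_3 -> 'I_e}}| = (e ^ 3)%N.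
Proof. by rewrite card_ffun !card_ord. Qed.

Lemma box_dim e : dim_le (box e) (fun x : P => x = 0) (e ^ 3).
Proof.
rewrite -card_ffmon; apply: (dim_le_fin (s := fun w => 'X_[ffmon w])) => g bg.
by exists (fun w => g@_(ffmon w)); rewrite -boxE // subrr.
Qed.

Lemma mul_lin Q M (c : 'I_M -> K) (s : 'I_M -> P) :
  Q * (\sum_i c i *: s i) = \sum_i c i *: (Q * s i).
Proof. by rewrite mulr_sumr; apply: eq_bigr => i _; rewrite scalerAr. Qed.

(* A nonzerodivisor [Q] of degree [q] modulo [J]: each multiplication by [Q] makes
   room for all of the quotient by [J + (Q)] again. *)
Lemma grow J Q q e N k : ideal J -> (forall v, J (Q * v) -> J v) -> box q.+1 Q ->
    dim_ge (box e) (subsum J (rdvd Q)) N ->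
  dim_ge (box (e + k * q)) J (k * N).
Proof.
move=> iJ reg bQ ge; elim: k => [|k IH]; first exact: dim_ge0.
have sJ := ideal_subsp iJ; have iQ := ideal_rdvd Q.
have ge1 : dim_ge (fun x => box (e + k.+1 * q) x /\ rdvd Q x) J (k * N).
  apply: (dim_ge_map (T := fun v => Q * v) _ _ _ _ IH); first exact: mul_lin.
  - move=> x bx; split; last by exists x; rewrite mulrC.
    by apply: box_leq (boxM bQ bx); rewrite mulSn; lia.
  - exact: box_subsp.
  - by move=> x _; exact: reg.
have ge2 : dim_ge (box (e + k.+1 * q)) (subsum J (rdvd Q)) N.
  by apply: dim_geS ge => // x; apply: box_leq; rewrite leq_addr.
have sB := ideal_subsp (ideal_subsum iJ iQ).
have ge3 := dim_ge_cat (A := box (e + k.+1 * q)) _ sB ge2 ge1.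
rewrite mulSn; apply: dim_geS (ge3 _) => //.
  by move=> x Jx; split=> //; apply: subsuml Jx; exact: ideal_subsp.
by move=> x [bx Qx]; split=> //; exact: subsumr.
Qed.

(** [grow] over the zero ideal packs [k] copies of the quotient into the box of side [2 k a], of
    dimension [8 k^3 a^3]. *)
Lemma principal_dim f a k N : f != 0 -> (0 < a)%N -> box a.+1 f ->
  dim_ge (box (k * a)) (rdvd f) N -> (N <= 8 * k ^ 2 * a ^ 3)%N.
Proof.
move=> f0 a0 bf ge.
have ge' : dim_ge (box (k * a)) (subsum (fun x => x = 0) (rdvd f)) N.
  by apply: dim_geS ge => // _ [_ [y [-> fy ->]]]; rewrite add0r.
have [k0|k0] := posnP k.
  have := dim_ge_leq (ideal_subsp (ideal_rdvd f)) ge.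
  rewrite k0 mul0n => /(_ 0%N) h; rewrite (leq_trans (h _)) //; apply: dim_leS (box_dim 0) => // x ->; exact: rdvd_0.
have reg v : f * v = 0 -> v = 0 by move/eqP; rewrite mulf_eq0 (negPf f0) => /eqP.
have := dim_ge_leq (ideal_subsp ideal_eq0) (grow k ideal_eq0 reg bf ge') (box_dim _).
by move=> h; rewrite -(leq_pmul2l k0) (leq_trans h) //; apply/eq_leq; ring.
Qed.

(* The Hilbert function of [I] grows linearly: [c] plays the role of the degree
   of a curve, and the constant 32 absorbs the sloppiness of [grow]. *)
Definition thin I c := (0 < c)%N /\
  forall m N, dim_ge (box (c * m)) I N -> (N <= 32 * c ^ 2 * m)%N.

(** [grow] modulo [f] packs [k a] copies into the box of side [2 k b a], where [principal_dim]
    allows [8 (2 k b)^2 a^3] dimensions; dividing by [k a] leaves [32 (a b)^2 k], the origin of the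
    32 in [thin]. *)
Lemma thin_pair f g a b : prime_elt f -> ~ rdvd f g -> (0 < a)%N -> (0 < b)%N ->
  box a.+1 f -> box b.+1 g -> thin (subsum (rdvd f) (rdvd g)) (a * b).
Proof.
move=> [/eqP f0 f1 fP] fg a0 b0 bf bg; split=> [|k N ge]; first by rewrite muln_gt0 a0.
have [k0|k0] := posnP k.
  have := dim_ge_leq (ideal_subsp (ideal_subsum (ideal_rdvd f) (ideal_rdvd g))) ge.
  rewrite k0 muln0 => /(_ 0%N) h; rewrite (leq_trans (h _)) //; apply: dim_leS (box_dim 0) => // x ->.
  by have [] := ideal_subsum (ideal_rdvd f) (ideal_rdvd g).
have reg v : rdvd f (g * v) -> rdvd f v by move/fP => [].
have := grow (k * a) (ideal_rdvd f) reg bg ge.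
have -> : (a * b * k + k * a * b = (2 * k * b) * a)%N by ring.
move/(principal_dim f0 a0 bf) => h; rewrite -(@leq_pmul2l (k * a)) ?muln_gt0 ?k0 //.
by apply: leq_trans h _; apply/eq_leq; ring.
Qed.

Lemma thinS I J c : (forall x, I x -> J x) -> thin I c -> thin J c.
Proof. by move=> IJ [c0 H]; split=> // m N ge; apply: H; apply: dim_geS ge. Qed.

(** With [m] bounding the sizes of the representatives, [grow] yields [j N <= 32 c (m + j q)] for
    all [j]; a large [j] removes [m]. This is the form of Bezout that serves both for distinct
    points and for germs at one point. *)
Lemma thin_codim I c Q q N : prime_ideal I -> thin I c -> ~ I Q -> box q.+1 Q ->
  dim_ge (fun _ => True) (subsum I (rdvd Q)) N -> (N <= 32 * c * q)%N.
Proof.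
move=> [iI I1 IP] [c0 thinI] nQ bQ [s [_ sfree]].
pose m := \max_(i < N) msize (s i).
have ge : dim_ge (box (c * m)) (subsum I (rdvd Q)) N.
  exists s; split=> // i; apply: box_leq (box_msize (leqnn _)).
  apply: leq_trans (leq_pmull m c0).
  exact: (@leq_bigmax _ (fun i => msize (s i)) i).
have reg v : I (Q * v) -> I v by move/IP => [].
have lim j : (j * N <= 32 * c * (m + j * q))%N.
  have := grow (c * j) iI reg bQ ge.
  have -> : (c * m + c * j * q = c * (m + j * q))%N by ring.
  by move/thinI => h; rewrite -(leq_pmul2l c0) mulnA (leq_trans h) //; apply/eq_leq; ring.
rewrite leqNgt; apply/negP => lt; have := lim (32 * c * m).+1.
rewrite leqNgt => /negP; apply; apply: leq_trans (leq_mul (leqnn _) lt).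
set j := (32 * c * m).+1.
have -> : (32 * c * (m + j * q) = 32 * c * m + j * (32 * c * q))%N by ring.
by rewrite mulnS ltn_add2r.
Qed.

End Boxes.

(** * Curves and surfaces *)

Section Fibers.
Variable K : numClosedFieldType.
Local Notation P := {mpoly K[3]}.
Local Notation pt := 'rV[K]_3.
Implicit Types (f g h : P) (x y : pt).

Definition upd k x t : pt := \row_j if j == k then t else x 0 j.

Definition fiber_poly h k x : {poly K} :=
  mmap polyC (fun j => if j == k then 'X else (x 0 j)%:P) h.

Definition noX k h := forall m, m \in msupp h -> m k = 0%N.

Definition coefk h k l : P := \sum_(m <- msupp h | m k == l)
  h@_m *: 'X_[[multinom if j == k then 0%N else m j | j < 3]].

Lemma evM f g x : ev (f * g) x = ev f x * ev g x. Proof. exact: mevalM. Qed.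
Lemma evD f g x : ev (f + g) x = ev f x + ev g x. Proof. exact: mevalD. Qed.
Lemma evB f g x : ev (f - g) x = ev f x - ev g x. Proof. exact: mevalB. Qed.
Lemma evZ c f x : ev (c *: f) x = c * ev f x. Proof. exact: mevalZ. Qed.
Lemma evC c x : ev c%:MP x = c. Proof. exact: mevalC. Qed.
Lemma ev0 x : ev 0 x = 0. Proof. exact: meval0. Qed.
Lemma ev1 x : ev 1 x = 1. Proof. exact: meval1. Qed.
Lemma evX i x : ev 'X_i x = x 0 i. Proof. exact: mevalXU. Qed.
Lemma ev_sum (I : Type) (r : seq I) (p : pred I) F x :
  ev (\sum_(i <- r | p i) F i) x = \sum_(i <- r | p i) ev (F i) x.
Proof. exact: (big_morph _ (fun f g => evD f g x) (ev0 x)). Qed.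
Lemma ev_prod (I : Type) (r : seq I) (p : pred I) F x :
  ev (\prod_(i <- r | p i) F i) x = \prod_(i <- r | p i) ev (F i) x.
Proof. exact: (big_morph _ (fun f g => evM f g x) (ev1 x)). Qed.

Lemma horner_fiber h k x t : (fiber_poly h k x).[t] = ev h (upd k x t).
Proof.
rewrite /fiber_poly /mmap horner_sum /ev mevalE; apply: eq_bigr => m _.
rewrite hornerM hornerC horner_prod; congr (_ * _); apply: eq_bigr => j _.
by rewrite hornerE !mxE; case: eqP => _; rewrite ?hornerX ?hornerC.
Qed.

Lemma coef_fiber h k x l : (fiber_poly h k x)`_l = ev (coefk h k l) x.
Proof.
rewrite /fiber_poly /mmap coef_sum /coefk ev_sum [RHS]big_mkcond; apply: eq_bigr => m _.
have -> : mmap1 (fun j => if j == k then 'X else (x 0 j)%:P) m =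
   (\prod_(j | j != k) x 0 j ^+ m j)%:P * 'X^(m k).
  rewrite /mmap1 (bigD1 k) //= eqxx mulrC; congr (_ * _); rewrite rmorph_prod /=.
  by apply: eq_bigr => j /negPf->; rewrite rmorphXn.
rewrite mulrA -rmorphM /= coefCM coefXn eq_sym; case: eqP => _; last by rewrite mulr0.
rewrite mulr1 evZ; congr (_ * _); rewrite /ev mevalX [RHS](bigD1 k) //= mnmE eqxx expr0 mul1r.
by apply: eq_bigr => j /negPf jk; rewrite mnmE jk.
Qed.

Lemma noX_coefk h k l : noX k (coefk h k l).
Proof.
move=> m /msupp_sum_le/flatten_mapP[m' _] /msuppZ_le; rewrite msuppX inE => /eqP->.
by rewrite mnmE eqxx.
Qed.

Lemma noX_coefk_other h k j l : noX j h -> noX j (coefk h k l).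
Proof.
move=> nj m /msupp_sum_le/flatten_mapP[m' + ] /msuppZ_le; rewrite msuppX inE mem_filter.
by move=> /andP[_ /nj mj] /eqP->; rewrite mnmE mj if_same.
Qed.

Lemma coefk_neq0 h k m : m \in msupp h -> coefk h k (m k) != 0.
Proof.
move=> mh; set m0 := [multinom if j == k then 0%N else m j | j < 3].
have : (coefk h k (m k))@_m0 != 0; last by apply: contraNneq => ->; rewrite mcoeff0.
rewrite /coefk raddf_sum /= big_mkcond (bigD1_seq m) //= eqxx.
rewrite mcoeffZ mcoeffX eqxx mulr1 big1 ?addr0 -?mcoeff_msupp // => m' mm'.
case: eqP => // mk.
rewrite mcoeffZ mcoeffX; case: eqP => [/mnmP e|]; last by rewrite mulr0.
case/eqP: mm'; apply/mnmP => j; have := e j; rewrite !mnmE.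
by case: (eqVneq j k) => [->|].
Qed.

Lemma noX_upd k h x t : noX k h -> ev h (upd k x t) = ev h x.
Proof.
move=> nk; rewrite /ev !mevalE; apply: eq_big_seq => m /nk mk; congr (_ * _).
by apply: eq_bigr => j _; rewrite mxE; case: eqP => // ->; rewrite mk !expr0.
Qed.

Lemma ex_coefk h k : h != 0 -> exists l, coefk h k l != 0.
Proof.
rewrite -msupp_eq0; case E: (msupp h) => [|m s] // _.
by exists (m k); apply: coefk_neq0; rewrite E mem_head.
Qed.

Lemma coefk_nonvanish h k l x : ev (coefk h k l) x != 0 -> exists t, ev h (upd k x t) != 0.
Proof.
rewrite -coef_fiber => c0; have : fiber_poly h k x != 0.
  by apply: contraNneq c0 => ->; rewrite coef0.
by move/closed_nonrootP => [t]; rewrite /root horner_fiber; exists t.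
Qed.

Lemma nonvanishing_point h : h != 0 -> exists x, ev h x != 0.
Proof.
move=> h0; have [l h1] := ex_coefk 0 h0; have [l' h2] := ex_coefk 1 h1.
have [l'' h3] := ex_coefk 2 h2; set g := coefk _ _ _ in h3.
have gC : g = (g@_0)%:MP.
  apply/mpolyP => m; rewrite mcoeffC; case: eqP => [->|m0]; first by rewrite mulr1.
  rewrite mulr0; apply/eqP; rewrite mcoeff_eq0; apply/negP => mg; apply: m0.
  apply/mnmP => j; rewrite mnm0E; have: noX j g; last exact.
  case: j => -[|[|[|//]]] lj.
  - rewrite (_ : Ordinal lj = 0); last exact: val_inj.
    by do 2!apply: noX_coefk_other; exact: noX_coefk.
  - rewrite (_ : Ordinal lj = 1); last exact: val_inj.
    by apply: noX_coefk_other; exact: noX_coefk.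
  - rewrite (_ : Ordinal lj = 2); last exact: val_inj.
    exact: noX_coefk.
have /coefk_nonvanish[t /coefk_nonvanish[t' /coefk_nonvanish[t'' H]]] : ev g 0 != 0.
  by rewrite gC evC; apply: contraNneq h3 => e; rewrite gC e mpolyC0.
by eexists; exact: H.
Qed.

Lemma fiber_root h k m x : m \in msupp h -> m k != 0%N ->
  ev (coefk h k (m k)) x != 0 -> exists t, ev h (upd k x t) = 0.
Proof.
move=> mh mk; rewrite -coef_fiber => c0.
have : size (fiber_poly h k x) != 1.
  apply: contraNneq c0 => s1; rewrite nth_default // s1.
  by case: (m k) mk.
by move/closed_rootP => [t /eqP]; rewrite horner_fiber; exists t.
Qed.

(** The projection of [Z(h)] along coordinate [k] is dense: where the coefficient of a positive
    power of [X_k] is nonzero, the fiber polynomial is nonconstant and has a root. *)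
Lemma surface_nonvanish h k m g : m \in msupp h -> m k != 0%N -> g != 0 -> noX k g ->
  exists x, ev h x = 0 /\ ev g x != 0.
Proof.
move=> mh mk g0 ng; have [x] := nonvanishing_point (mulf_neq0 g0 (coefk_neq0 k mh)).
rewrite evM mulf_eq0 negb_or => /andP[gx /(fiber_root mh mk)[t ht]].
by exists (upd k x t); split=> //; rewrite noX_upd.
Qed.

Lemma nonconst_var h : h != 0 -> ~ rdvd h 1 -> exists k m, m \in msupp h /\ m k != 0%N.
Proof.
move=> h0 nh; apply: contrapT => H; apply: nh.
have hC : h = (h@_0)%:MP.
  apply/mpolyP => m; rewrite mcoeffC; case: eqP => [->|m0]; first by rewrite mulr1.
  rewrite mulr0; apply/eqP; rewrite mcoeff_eq0; apply/negP => mg; apply: m0.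
  apply/mnmP => j; rewrite mnm0E; apply: contrapT => /eqP mj; apply: H.
  by exists j, m.
have c0 : h@_0 != 0 by apply: contraNneq h0 => e; rewrite hC e mpolyC0.
by exists (h@_0)^-1%:MP; rewrite [X in _ * X]hC -mpolyCM mulVf.
Qed.

End Fibers.

(** * Irreducible curves and bounds of Bezout type *)

Section Curves.
Variable K : numClosedFieldType.
Local Notation P := {mpoly K[3]}.
Local Notation pt := 'rV[K]_3.
Implicit Types (f g h Q : P) (x y : pt) (A B : cset K).

Lemma ideal_Iof A : ideal (Iof A).
Proof.
split=> [x _|f g If Ig x Ax|a f If x Ax]; first by rewrite ev0.
  by rewrite evD If ?Ig ?addr0.
by rewrite evM If ?mulr0.
Qed.

Lemma algebraicI1 A Q : algebraic A -> algebraic (fun x => A x /\ ev Q x = 0).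
Proof.
move=> [s sP]; exists (Q :: s) => x; split=> [[/sP Ax Qx] p|H].
  by rewrite inE => /orP[/eqP->//|/Ax].
split; last by apply: H; rewrite mem_head.
by apply/sP => p ps; apply: H; rewrite inE ps orbT.
Qed.

Lemma irr_curve_prime A : irr_curve A -> prime_ideal (Iof A).
Proof.
move=> [[Aalg [x0 Ax0] irr] _ _]; split; first exact: ideal_Iof.
  by move=> /(_ x0 Ax0); rewrite ev1 => /eqP; rewrite oner_eq0.
move=> a b Iab; have [|H|H] := irr _ _ (algebraicI1 a Aalg) (algebraicI1 b Aalg).
- move=> x; split=> [Ax|[[]|[]] //]; have /eqP := Iab x Ax.
  by rewrite evM mulf_eq0 => /orP[/eqP ax|/eqP bx]; [left|right].
- by left=> x /H[].
- by right=> x /H[].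
Qed.

Lemma irr_curve_sub A B : irr_curve A -> irr_curve B -> csub A B -> cseteq A B.
Proof.
move=> [[Aalg _ _] Ainf _] [_ _ Bmin] AB; apply: contrapT => ne.
exact: Ainf (Bmin A Aalg AB ne).
Qed.

Lemma irr_curve_coord A x : irr_curve A -> exists l, ~ Iof A ('X_l - (x 0 l)%:MP).
Proof.
move=> [_ Ainf _]; apply/existsNP => H; apply: Ainf; exists [:: x] => y Ay.
rewrite inE; apply/eqP/rowP => l; have := H l y Ay.
by rewrite evB evX evC => /eqP; rewrite subr_eq0 => /eqP.
Qed.

Lemma irr_curve_free_coord A : irr_curve A -> exists l, forall c, ~ Iof A ('X_l - c%:MP).
Proof.
move=> cA; case: (cA) => [[_ [x Ax] _] _ _].
have [l nl] := irr_curve_coord x cA; exists l => c Ic; apply: nl => y Ay.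
have := Ic x Ax; have := Ic y Ay; rewrite !evB !evX !evC => /eqP + /eqP.
by rewrite !subr_eq0 => /eqP-> /eqP->; rewrite subrr.
Qed.

Lemma other_var (k : 'I_3) : exists i j : 'I_3,
  [/\ i != j, i != k, j != k & forall l, [\/ l = i, l = j | l = k]].
Proof.
have c3 (l : 'I_3) : [\/ l = 0, l = 1 | l = 2].
  by case: l => -[|[|[|//]]] h; [apply: Or31|apply: Or32|apply: Or33]; apply: val_inj.
case: (c3 k) => ->.
- by exists 1, 2; split=> //; move=> l; case: (c3 l); [apply: Or33|apply: Or31|apply: Or32].
- by exists 0, 2; split=> //; move=> l; case: (c3 l); [apply: Or31|apply: Or33|apply: Or32].
- by exists 0, 1.
Qed.

Lemma noX_XsubC k i c : i != k -> noX k ('X_i - c%:MP : P).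
Proof.
move=> ik m /msuppB_le; rewrite mem_cat msuppX inE msuppC => /orP[/eqP->|].
  by rewrite mnm1E (negPf ik).
by case: eqP => // _; rewrite inE => /eqP->; rewrite mnm0E.
Qed.

Lemma XsubC_neq0 i c : 'X_i - c%:MP != 0 :> P.
Proof.
apply/eqP => /(congr1 (mcoeff U_(i)%MM)); rewrite mcoeffB mcoeffX mcoeffC eqxx mcoeff0.
by rewrite mnm1_eq0 mulr0 subr0 => /eqP; rewrite oner_eq0.
Qed.

(** A plane section of [A] is finite or all of [A]. The section of the surface by [X_i = x_i] has
    points over all but finitely many values of [X_j], and the surface does not lie in that
    plane. *)
Lemma surface_not_sub_curve A h : irr_curve A -> h != 0 -> ~ rdvd h 1 ->
  ~ csub (Zf h) A.
Proof.
move=> cA h0 h1 hA; have [k [m [mh mk]]] := nonconst_var h0 h1.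
have [i [j [ij ik jk _]]] := other_var k.
have [x ax] := nonvanishing_point (coefk_neq0 k mh).
case: (cA) => [[Aalg _ _] _ Amin].
have [eqA|neA] := pselect (cseteq (fun y => A y /\ ev ('X_i - (x 0 i)%:MP) y = 0) A).
  have [y [hy]] := surface_nonvanish mh mk (XsubC_neq0 i (x 0 i)) (@noX_XsubC k i _ ik).
  by case/eqP; case: (eqA y) => _ /(_ (hA y hy))[].
have [s sP] := Amin _ (algebraicI1 _ Aalg) (fun y => @proj1 _ _) neA.
(* Its roots are the values of [X_j] to avoid: those where a root in the fiber is not guaranteed,
   and the [j]-th coordinates of the points listed in [s]. *)
pose q := fiber_poly (coefk h k (m k)) j x * \prod_(y <- s) ('X - (y 0 j)%:P).
have q0 : q != 0.
  rewrite mulf_neq0 //; last first.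
    by rewrite prodf_seq_neq0; apply/allP => y _ /=; rewrite polyXsubC_eq0.
  apply: contraNneq ax => e; have -> : x = upd j x (x 0 j).
    by apply/rowP => l; rewrite mxE; case: eqP => [->|].
  by rewrite -horner_fiber e horner0.
have /closed_nonrootP[t] := q0; rewrite /root hornerM mulf_eq0 negb_or => /andP[].
rewrite horner_fiber => /(fiber_root mh mk)[u hu] /negP; apply.
set z := upd k _ u in hu; have zs : z \in s.
  apply: sP; split; first exact: hA.
  by rewrite evB evX evC !mxE (negPf ik) (negPf ij) subrr.
rewrite horner_prod (big_rem z zs) /= hornerXsubC !mxE (negPf jk) eqxx subrr mul0r //.
Qed.

(** Degree is measured on equations, the form in which it separates curves and feeds [thin_pair]. *)
Definition Ecurve e A := irr_curve A /\ exists s : seq P,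
  (forall q, q \in s -> (msize q <= e.+1)%N) /\ cseteq A (Zs s).

Lemma Ecurve_separate e A B : Ecurve e A -> Ecurve e B -> ~ cseteq A B ->
  exists q, [/\ (msize q <= e.+1)%N, Iof A q & ~ Iof B q].
Proof.
move=> [cA [s [ss sA]]] [cB _] ne; apply: contrapT => H; apply: ne.
have BA : csub B A.
  move=> x Bx; apply/sA => q qs; apply: contrapT => qx; apply: H.
  exists q; split; [exact: ss|by move=> y /sA; apply|by move/(_ x Bx)].
by move=> x; have := irr_curve_sub cB cA BA x; tauto.
Qed.

Lemma prime_ideal_prod (I : P -> Prop) (s : seq P) : prime_ideal I ->
  I (\prod_(q <- s) q) -> exists2 q, q \in s & I q.
Proof.
case=> iI I1 IP; elim: s => [|q s IH]; first by rewrite big_nil.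
rewrite big_cons => /IP[Iq|/IH[r rs Ir]]; first by exists q; rewrite ?mem_head.
by exists r => //; rewrite inE rs orbT.
Qed.

(** A prime factor [p] of some nonzero equation lies in the prime ideal of [A], and some equation is
    not divisible by [p]; otherwise [A] would contain a surface. *)
Lemma Ecurve_thin e A : (0 < e)%N -> Ecurve e A -> thin (Iof A) (e * e).
Proof.
move=> e0 [cA [s [ss sA]]]; have pI := irr_curve_prime cA; have [iI I1 IP] := pI.
have sI q : q \in s -> Iof A q by move=> qs y /sA; apply.
have [q qs q0] : exists2 q, q \in s & q != 0.
  apply: contrapT => H.
  apply: (surface_not_sub_curve cA (h := 'X_0)); first by have := XsubC_neq0 0 0; rewrite subr0.
    by move/unit_msize; rewrite msizeX mdeg1.
  move=> x _; apply/sA => q qs; have [->|q0] := eqVneq q 0; first exact: ev0.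
  by case: H; exists q.
have [u [ps [[v vu] psP eq]]] := mpoly_factorial (elimN eqP q0).
have [p pps Ip] : exists2 p, p \in ps & Iof A p.
  apply: (prime_ideal_prod pI); have := sI q qs; rewrite eq => /IP[Iu|//].
  by case: I1; rewrite vu; case: iI => _ _; apply.
have [p0 p1 pP] := psP p pps.
have pq : rdvd p q by rewrite eq (big_rem p pps) /=; exact/rdvd_mull/rdvd_mulr/rdvd_refl.
have [g gs ng] : exists2 g, g \in s & ~ rdvd p g.
  apply: contrapT => H; apply: (surface_not_sub_curve cA (h := p)) => //; first exact/eqP.
  move=> x px; apply/sA => g gs; have [[c ->]|ng] := pselect (rdvd p g).
    by rewrite evM px mulr0.
  by case: H; exists g.
apply: thinS (thin_pair (psP p pps) ng e0 e0 _ _).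
- by move=> _ [_ [_ [[c ->] [d ->] ->]]]; case: iI => _ ID IM; apply: ID; apply: IM => //; exact: sI.
- by apply/box_msize/(leq_trans (rdvd_msize q0 pq))/ss.
- exact/box_msize/ss.
Qed.

Lemma points_dim (J : P -> Prop) (s : seq pt) : uniq s ->
    (forall x, x \in s -> forall g, J g -> ev g x = 0) ->
  dim_ge (fun _ => True) J (size s).
Proof.
move=> us sJ.
have sep x y : exists q : P, ev q x = 0 /\ (x != y -> ev q y != 0).
  have [->|ne] := eqVneq x y; first by exists 0; rewrite ev0.
  have [l nl] : exists l, x 0 l != y 0 l.
    by apply: contrapT => H; case/eqP: ne; apply/rowP => l; apply: contrapT => /eqP nl; apply: H; exists l.
  exists ('X_l - (x 0 l)%:MP); rewrite !evB !evX !evC subrr; split=> // _.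
  by rewrite subr_eq0 eq_sym.
pose L x y := projT1 (cid (sep x y)).
have L0 x y : ev (L x y) x = 0 by rewrite /L; case: cid => q [].
have L1 x y : x != y -> ev (L x y) y != 0 by rewrite /L; case: cid => q [].
pose pnt (i : 'I_(size s)) := s`_i.
have pinj i j : (pnt i == pnt j) = (i == j) by rewrite /pnt nth_uniq.
exists (fun i => \prod_(j | j != i) L (pnt j) (pnt i)); split=> // c /(sJ _ _) Jc i.
have := Jc (pnt i) (mem_nth _ _); rewrite ltn_ord => /(_ isT).
rewrite ev_sum (bigD1 i) //= [X in _ + X]big1 ?addr0 => [|j ji]; last first.
  by rewrite evZ ev_prod (bigD1 i) /= ?L0 ?mul0r ?mulr0 // eq_sym.
rewrite evZ ev_prod => /eqP; rewrite mulf_eq0 => /orP[/eqP//|].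
rewrite (negPf (_ : \prod_(j | _) _ != 0)) //; apply/prodf_neq0 => j ji.
by apply: L1; rewrite pinj.
Qed.

Lemma curve_bezout e A Q q (s : seq pt) : (0 < e)%N -> Ecurve e A -> ~ Iof A Q -> box q.+1 Q ->
  uniq s -> (forall x, x \in s -> A x /\ ev Q x = 0) -> (size s <= 32 * (e * e) * q)%N.
Proof.
move=> e0 cA nQ bQ us sP.
apply: (thin_codim (irr_curve_prime cA.1) (Ecurve_thin e0 cA) nQ bQ).
apply: points_dim => // x /sP[Ax Qx] _ [a [_ [Ia [b ->] ->]]].
by rewrite evD evM Qx mulr0 addr0 Ia.
Qed.

(** Powers of a coordinate that is not constant on [A] are independent: a relation factors into
    linear polynomials, one of which would lie in the prime ideal. *)
Lemma curve_dim A e : irr_curve A -> dim_ge (box e) (Iof A) e.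
Proof.
move=> cA; have [l nl] := irr_curve_free_coord cA; have [iI I1 IP] := irr_curve_prime cA.
exists (fun i : 'I_e => 'X_l ^+ i); split=> [i|c].
  rewrite mpolyXn => m; rewrite msuppX inE => /eqP-> j.
  by rewrite mulmnE mnm1E; case: eqP => _; rewrite ?mul1n ?mul0n //; case: (i) => k; case: (e).
pose q := \poly_(i < e) (if insub i is Some j then c j else 0).
have qc (i : 'I_e) : q`_i = c i by rewrite coef_poly ltn_ord valK.
have -> : \sum_i c i *: 'X_l ^+ i = (map_poly (@mpolyC 3 K) q).['X_l].
  rewrite (@horner_coef_wide _ e); last by rewrite (leq_trans (size_poly _ _)) // size_poly.
  by apply: eq_bigr => i _; rewrite coef_map /= qc mul_mpolyC.
move=> Iq i; rewrite -qc; suff -> : q = 0 by rewrite coef0.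
apply: contrapT => /eqP q0; have [r er] := closed_field_poly_normal q.
have : Iof A ((map_poly (@mpolyC 3 K) q).['X_l]) by [].
rewrite er linearZ /= hornerZ => /IP[Ilc|].
  apply: I1; rewrite -(mpolyC1 3) -(mulVf (_ : lead_coef q != 0)) ?lead_coef_eq0 //.
  by rewrite mpolyCM; case: iI => _ _; apply.
rewrite rmorph_prod horner_prod /= -(big_map _ xpredT id).
case/(prime_ideal_prod (irr_curve_prime cA)) => _ /mapP[z _ ->].
by rewrite rmorphB /= map_polyX map_polyC !hornerE; exact: nl.
Qed.

Definition distinct_sets (gs : seq (cset K)) := forall i j, (i < size gs)%N -> (j < size gs)%N ->
  i != j -> ~ cseteq (nth (@cset0 K) gs i) (nth (@cset0 K) gs j).

(** Multiplication by a [Q] vanishing on the other curves but not on [A] adds the linear growth on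
    [A] to theirs; [e0] accumulates the sizes of these multipliers. *)
Lemma curves_union_dim (gs : seq (cset K)) : distinct_sets gs ->
    (forall i, (i < size gs)%N -> irr_curve (nth (@cset0 K) gs i)) ->
  exists e0, forall e, dim_ge (box (e0 + e))
    (fun g => forall i, (i < size gs)%N -> Iof (nth (@cset0 K) gs i) g) (size gs * e).
Proof.
elim: gs => [|A gs IH] dis cgs; first by exists 0%N => e; exact: dim_ge0.
have [||e0 H] := IH.
- by move=> i j ig jg ij; apply: (dis i.+1 j.+1).
- by move=> i ig; apply: (cgs i.+1).
have cA : irr_curve A by exact: (cgs 0%N).
have [iI I1 IP] := irr_curve_prime cA.
have [Q [Qgs QA]] : exists Q, (forall i, (i < size gs)%N -> Iof (nth (@cset0 K) gs i) Q) /\ ~ Iof A Q.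
  have sep (i : 'I_(size gs)) : exists q, Iof (nth (@cset0 K) gs i) q /\ ~ Iof A q.
    apply: contrapT => H1; have cB := cgs i.+1 (ltn_ord i); have [[[s sB] _ _] _ _] := cB.
    apply: (dis 0%N i.+1) => //; first exact: (ltn_ord i).
    apply: irr_curve_sub => // x Ax; apply/sB => q qs; apply: contrapT => qx; apply: H1.
    by exists q; split=> [y /sB|/(_ x Ax)//]; apply.
  exists (\prod_i projT1 (cid (sep i))); split=> [i ig x Ax|].
    rewrite ev_prod (bigD1 (Ordinal ig)) //=.
    by case: cid => q [/= Iq _]; rewrite Iq ?mul0r.
  apply: (big_ind (fun Q => ~ Iof A Q)) => // [a b na nb /IP[]//|i _].
  by case: cid => q [].
pose q := msize Q; exists (e0 + q)%N => e.
have sJ : subsp (fun g => forall i, (i < size gs)%N -> Iof (nth (@cset0 K) gs i) g).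
  split=> [i _|x y Jx Jy i ig|c x Jx i ig].
  - by have [] := ideal_Iof (nth (@cset0 K) gs i).
  - by have [_ D _] := ideal_Iof (nth (@cset0 K) gs i); apply: D; [exact: Jx|exact: Jy].
  - by have [_ _ Z] := ideal_subsp (ideal_Iof (nth (@cset0 K) gs i)); apply/Z/Jx.
have ge1 : dim_ge (box (e0 + q + e)) (fun g => forall i, (i < size gs)%N -> Iof (nth (@cset0 K) gs i) g) (size gs * e).
  by apply: dim_geS (H e) => // x; apply: box_leq; lia.
have ge2 : dim_ge (fun x : P => box (e0 + q + e) x /\ forall i, (i < size gs)%N -> Iof (nth (@cset0 K) gs i) x) (Iof A) e.
  apply: (dim_ge_map (T := fun v => Q * v) _ _ (@box_subsp _ e) _ (curve_dim e cA)).
  - exact: mul_lin.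
  - move=> x bx; split; first by apply: box_leq (boxM (box_msize (leqnSn q)) bx); lia.
    by move=> i ig; apply: (idealMr _ (ideal_Iof _)); exact: Qgs.
  - by move=> x _ /IP[].
rewrite /= mulSnr; apply: dim_geS (dim_ge_cat _ sJ ge1 ge2) => // x H1.
by split=> [i ig|]; [exact: (H1 i.+1)|exact: (H1 0%N)].
Qed.

Lemma curves_bezout (J : P -> Prop) c (gs : seq (cset K)) : thin J c -> distinct_sets gs ->
    (forall i, (i < size gs)%N -> irr_curve (nth (@cset0 K) gs i)) ->
    (forall i, (i < size gs)%N -> forall g, J g -> Iof (nth (@cset0 K) gs i) g) ->
  (size gs <= 32 * c)%N.
Proof.
move=> [c0 thinJ] dis cgs Jgs; have [e0 H] := curves_union_dim dis cgs.
have lim j : (size gs * j <= 32 * c * (e0 + j))%N.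
  have : dim_ge (box (c * (e0 + j))) J (size gs * (c * j)).
    apply: dim_geS (H (c * j)%N) => // x; last by move=> Jx i ig; exact: Jgs.
    by apply: box_leq; rewrite mulnDr leq_add2r leq_pmull.
  move/thinJ => h; rewrite -(leq_pmul2l c0).
  by apply: leq_trans (leq_trans _ h) _; apply/eq_leq; ring.
rewrite leqNgt; apply/negP => lt; have := lim (32 * c * e0).+1.
rewrite leqNgt => /negP; apply; apply: leq_trans (leq_mul lt (leqnn _)).
set j := (32 * c * e0).+1.
by rewrite mulnDr [X in (_ < X)%N]mulSn ltn_add2r.
Qed.

End Curves.

(** * Local intersection theory *)

Section LocalPowers.
Variable K : numClosedFieldType.
Local Notation P := {mpoly K[3]}.
Local Notation pt := 'rV[K]_3.
Variable p : pt.
Implicit Types (f g h : P).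

Definition shX (l : 'I_3) : P := 'X_l - (p 0 l)%:MP.

(* The [N]-th power of the maximal ideal of [p]. *)
Fixpoint mp N g : Prop := if N is N'.+1 then
  exists h : 'I_3 -> P, (forall l, mp N' (h l)) /\ g = \sum_l shX l * h l else True.

Lemma ideal_mp N : ideal (mp N).
Proof.
elim: N => [|N [I0 ID IM]]; first by split.
split.
- by exists (fun=> 0); split=> //; rewrite big1 // => l _; rewrite mulr0.
- move=> _ _ [h [hN ->]] [h' [hN' ->]]; exists (fun l => h l + h' l); split.
    by move=> l; exact: ID (hN l) (hN' l).
  by rewrite -big_split /=; apply: eq_bigr => l _; rewrite mulrDr.
- move=> a _ [h [hN ->]]; exists (fun l => a * h l); split; first by move=> l; exact: IM (hN l).
  by rewrite mulr_sumr; apply: eq_bigr => l _; rewrite mulrCA.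
Qed.

Lemma mp_mul a b f g : mp a f -> mp b g -> mp (a + b) (f * g).
Proof.
elim: a f => [|a IH] f /=; first by move=> _; case: (ideal_mp b) => _ _; apply.
move=> [h [ha ->]] gb; exists (fun l => h l * g); split; first by move=> l; exact: IH (ha l) gb.
by rewrite mulr_suml; apply: eq_bigr => l _; rewrite mulrA.
Qed.

Lemma mp_exp n g : mp 1 g -> mp n (g ^+ n).
Proof. by move=> g1; elim: n => [//|n IH]; rewrite exprS -[n.+1]add1n; exact: mp_mul. Qed.

Lemma mpW N g : mp N.+1 g -> mp N g.
Proof.
elim: N g => [//|N IH] g [h [hN ->]]; exists h; split=> // l; exact: IH (hN l).
Qed.

Lemma mp_leq N M g : (M <= N)%N -> mp N g -> mp M g.
Proof.
elim: N => [|N IH]; first by rewrite leqn0 => /eqP->.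
by rewrite leq_eqVlt => /orP[/eqP->//|MN /mpW]; exact: IH.
Qed.

Lemma mp_shX l : mp 1 (shX l).
Proof.
exists (fun j => (j == l)%:R); split=> //.
by rewrite (bigD1 l) //= eqxx mulr1 big1 ?addr0 // => j /negPf->; rewrite mulr0.
Qed.

Lemma ev_shX l : ev (shX l) p = 0. Proof. by rewrite evB evX evC subrr. Qed.

Lemma mp1_ev g : mp 1 g -> ev g p = 0.
Proof. by move=> [h [_ ->]]; rewrite ev_sum big1 // => l _; rewrite evM ev_shX mul0r. Qed.

Lemma mp1_sub_ev g : mp 1 (g - (ev g p)%:MP).
Proof.
have [I0 ID IM] := ideal_mp 1.
have cM a b : mp 1 (a - (ev a p)%:MP) -> mp 1 (b - (ev b p)%:MP) ->
    mp 1 (a * b - (ev (a * b) p)%:MP).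
  move=> Ha Hb; rewrite evM mpolyCM.
  rewrite (_ : _ - _ = b * (a - (ev a p)%:MP) + (ev a p)%:MP * (b - (ev b p)%:MP)); last by ring.
  by apply: ID; apply: IM.
elim/mpolyind: g => [|c m g _ _ IH]; first by rewrite ev0 subrr.
rewrite evD mpolyCD opprD addrACA; apply: ID => //; rewrite -mul_mpolyC.
apply: (cM); first by rewrite evC subrr.
rewrite mpolyXE_id; apply: (big_ind (fun g => mp 1 (g - (ev g p)%:MP))) => //.
  by rewrite ev1 subrr.
move=> l _; elim: (m l) => [|n IHn]; first by rewrite expr0 ev1 subrr.
by rewrite exprS; apply: (cM) => //; rewrite evX; exact: mp_shX.
Qed.

Lemma mp1P g : ev g p = 0 -> mp 1 g.
Proof. by move=> g0; have := mp1_sub_ev g; rewrite g0 subr0. Qed.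

Lemma mderiv_shX i l : (shX l)^`M(i) = (l == i)%:R.
Proof.
rewrite mderivB mderivC subr0 mderivX mnm1E; case: eqP => [->|_]; last by rewrite scale0r.
rewrite scale1r (_ : (_ - _)%MM = 0%MM) ?mpolyX0 //.
by apply/mnmP => j; rewrite mnmBE subnn mnm0E.
Qed.

Lemma mderiv_shX_sum i (h : 'I_3 -> P) :
  (\sum_l shX l * h l)^`M(i) = h i + \sum_l shX l * (h l)^`M(i).
Proof.
rewrite raddf_sum /=; under eq_bigr do rewrite mderivM mderiv_shX.
rewrite big_split /= (bigD1 i) //= eqxx mul1r big1 ?addr0 // => l /negPf->.
by rewrite mul0r.
Qed.

Lemma mp_mderiv N g i : mp N.+1 g -> mp N g^`M(i).
Proof.
elim: N g => [//|N IH] g [h [hN ->]]; rewrite mderiv_shX_sum.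
have [_ ID _] := ideal_mp N.+1; apply: ID => //.
by exists (fun l => (h l)^`M(i)); split=> // l; exact: IH (hN l).
Qed.

Fixpoint hom N g : Prop := if N is N'.+1 then
  exists h : 'I_3 -> P, (forall l, hom N' (h l)) /\ g = \sum_l shX l * h l
  else exists c, g = c%:MP.

Lemma homD N f g : hom N f -> hom N g -> hom N (f + g).
Proof.
elim: N f g => [|N IH] f g; first by move=> [c ->] [d ->]; exists (c + d); rewrite mpolyCD.
move=> [h [hN ->]] [h' [hN' ->]]; exists (fun l => h l + h' l); split=> [l|]; first exact: IH (hN l) (hN' l).
by rewrite -big_split /=; apply: eq_bigr => l _; rewrite mulrDr.
Qed.

Lemma hom_mderiv N g i : hom N.+1 g -> hom N g^`M(i).
Proof.
elim: N g => [|N IH] g [h [hN ->]]; rewrite mderiv_shX_sum.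
  rewrite big1 ?addr0 // => l _; have [c ->] := hN l.
  by rewrite mderivC mulr0.
by apply: homD => //; exists (fun l => (h l)^`M(i)); split=> // l; exact: IH (hN l).
Qed.

Lemma euler N g : hom N g -> \sum_l shX l * g^`M(l) = N%:R * g.
Proof.
elim: N g => [|N IH] g; first by move=> [c ->]; rewrite mul0r big1 // => l _; rewrite mderivC mulr0.
move=> [h [hN eg]].
have -> : \sum_l shX l * g^`M(l) = g + \sum_l shX l * \sum_j shX j * (h j)^`M(l).
  rewrite {1}eg; under eq_bigr do rewrite mderiv_shX_sum mulrDr.
  by rewrite big_split /= -eg.
under eq_bigr do rewrite mulr_sumr; rewrite exchange_big /=.
have -> : \sum_j \sum_l shX l * (shX j * (h j)^`M(l)) = N%:R * g.
  rewrite {1}eg mulr_sumr; apply: eq_bigr => j _; rewrite mulrCA -(IH _ (hN j)) mulr_sumr.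
  by apply: eq_bigr => l _; rewrite mulrCA.
by rewrite -natr1 mulrDl mul1r addrC.
Qed.

Lemma mp_leading_form N g : mp N g -> exists2 G, hom N G & mp N.+1 (g - G).
Proof.
elim: N g => [|N IH] g; first by move=> _; exists (ev g p)%:MP; [exists (ev g p)|exact: mp1_sub_ev].
move=> [h [/(_ _)/IH hN ->]].
pose G l := sval (cid2 (hN l)).
exists (\sum_l shX l * G l); first by exists G; split=> // l; rewrite /G; case: cid2.
exists (fun l => h l - G l); split=> [l|]; first by rewrite /G; case: cid2.
by rewrite -sumrB; apply: eq_bigr => l _; rewrite mulrBr.
Qed.

Lemma vanishes_toS g N i : vanishes_to g p N.+1 -> vanishes_to g^`M(i) p N.
Proof. by move=> H m mN; rewrite -mderivmU1m -mderivmDm; apply: H; rewrite mdegD mdeg1. Qed.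

Lemma vanishes_toW g N : vanishes_to g p N.+1 -> vanishes_to g p N.
Proof. by move=> H m mN; apply: H; exact: ltnW. Qed.

Lemma vanishes_toB f g N : vanishes_to f p N -> vanishes_to g p N -> vanishes_to (f - g) p N.
Proof. by move=> Hf Hg m mN; rewrite mderivmB evB Hf ?Hg ?subrr. Qed.

Lemma mp_vanishes_to N g : mp N g -> vanishes_to g p N.
Proof.
elim: N g => [//|N IH] g gN m mN; have [m0|/eqP m0] := eqVneq m 0%MM.
  rewrite m0 mderivm0m; apply: mp1_ev; exact: mp_leq gN.
have [i mi] : exists i, m i != 0%N.
  apply: contrapT => H; apply: m0; apply/mnmP => i; rewrite mnm0E.
  by apply: contrapT => /eqP mi; apply: H; exists i.
have e : m = (U_(i) + (m - U_(i)))%MM.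
  by apply/mnmP => j; rewrite mnmDE mnmBE mnm1E; case: eqP => [<-|_] /=; lia.
rewrite e mderivmDm mderivmU1m; apply: (IH _ (mp_mderiv i gN)).
have : mdeg m = (mdeg (m - U_(i))%MM).+1 by rewrite {1}e mdegD mdeg1.
by move: mN; lia.
Qed.

Lemma hom_vanishes_to N G : hom N G -> vanishes_to G p N.+1 -> G = 0.
Proof.
elim: N G => [|N IH] G homG van.
  have [c e] := homG; have := van 0%MM; rewrite mderivm0m mdeg0 e evC => /(_ isT)->.
  exact: mpolyC0.
have := euler homG; rewrite big1 => [/eqP|l _].
  by rewrite eq_sym mulf_eq0 -mpolyC_nat mpolyC_eq0 pnatr_eq0 /= => /eqP.
by rewrite (IH G^`M(l)) ?mulr0 //; [exact: hom_mderiv|exact: vanishes_toS].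
Qed.

(** By Euler's identity in characteristic zero, a form of degree [N] in the centered coordinates
    whose derivatives up to order [N] vanish at [p] is zero; this applies to the leading form of
    [g]. *)
Lemma vanishes_to_mp N g : vanishes_to g p N -> mp N g.
Proof.
elim: N => [//|N IH] van; have [G homG gG] := mp_leading_form (IH (vanishes_toW van)).
have G0 : G = 0.
  apply: (hom_vanishes_to homG); rewrite -[G](subKr g).
  by apply: vanishes_toB => //; exact: mp_vanishes_to.
by move: gG; rewrite G0 subr0.
Qed.

End LocalPowers.

(** * Vector fields and orders along them *)

Section Derivations.
Variable K : numClosedFieldType.
Local Notation P := {mpoly K[3]}.
Local Notation pt := 'rV[K]_3.
Variables (a : 'I_3 -> P) (p : pt).
Implicit Types (f g h : P).

Definition vfield g : P := \sum_l a l * g^`M(l).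

Lemma vfieldD f g : vfield (f + g) = vfield f + vfield g.
Proof. by rewrite -big_split /=; apply: eq_bigr => l _; rewrite mderivD mulrDr. Qed.

Lemma vfieldM f g : vfield (f * g) = vfield f * g + f * vfield g.
Proof.
rewrite /vfield mulr_suml mulr_sumr -big_split /=; apply: eq_bigr => l _.
by rewrite mderivM; ring.
Qed.

Lemma vfieldC c : vfield c%:MP = 0.
Proof. by rewrite /vfield big1 // => l _; rewrite mderivC mulr0. Qed.

Lemma vfield0 : vfield 0 = 0. Proof. by rewrite -(mpolyC0 3) vfieldC. Qed.

Lemma vfieldZ c f : vfield (c *: f) = c *: vfield f.
Proof. by rewrite -!mul_mpolyC vfieldM vfieldC mul0r add0r. Qed.

Lemma vfield_sum (I : Type) (r : seq I) (Q : pred I) F :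
  vfield (\sum_(i <- r | Q i) F i) = \sum_(i <- r | Q i) vfield (F i).
Proof. exact: (big_morph _ vfieldD vfield0). Qed.

Definition viter n := iter n vfield.

Lemma viterD n f g : viter n (f + g) = viter n f + viter n g.
Proof. by elim: n => [//|n IH]; rewrite /viter !iterS -!/(viter _ _) IH vfieldD. Qed.

Lemma viterZ n c f : viter n (c *: f) = c *: viter n f.
Proof. by elim: n => [//|n IH]; rewrite /viter !iterS -!/(viter _ _) IH vfieldZ. Qed.

Lemma viter0 n : viter n 0 = 0.
Proof. by elim: n => [//|n IH]; rewrite /viter !iterS -!/(viter _ _) IH vfield0. Qed.

Lemma viter_sum n (I : Type) (r : seq I) (Q : pred I) F :
  viter n (\sum_(i <- r | Q i) F i) = \sum_(i <- r | Q i) viter n (F i).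
Proof. exact: (big_morph _ (viterD n) (viter0 n)). Qed.

Lemma viterS n f : viter n.+1 f = viter n (vfield f). Proof. exact: iterSr. Qed.

(* Order of vanishing at [p] along the integral curve of the vector field. *)
Definition vord N g := forall j, (j < N)%N -> ev (viter j g) p = 0.

Lemma vordS N g : vord N.+1 g <-> ev g p = 0 /\ vord N (vfield g).
Proof.
split=> [H|[g0 H] [//|j] jN]; last by rewrite viterS; apply: H.
by split=> [|j jN]; [exact: (H 0%N)|rewrite -viterS; apply: H].
Qed.

Lemma vord_leq N M g : (M <= N)%N -> vord N g -> vord M g.
Proof. by move=> MN H j jM; apply: H; exact: leq_trans MN. Qed.

Lemma vordD N f g : vord N f -> vord N g -> vord N (f + g).
Proof. by move=> Hf Hg j jN; rewrite viterD evD Hf ?Hg ?addr0. Qed.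

Lemma vordMl N f g : vord N g -> vord N (f * g).
Proof.
elim: N f g => [//|N IH] f g H; have [g0 Hg] := (vordS N g).1 H.
apply/vordS; rewrite evM g0 mulr0; split=> //; rewrite vfieldM.
by apply: vordD; apply: IH => //; exact: vord_leq H.
Qed.

Lemma viter_lead N f g : vord N g ->
  ev (viter N (f * g)) p = ev f p * ev (viter N g) p.
Proof.
elim: N f g => [|N IH] f g H; first exact: evM.
have [g0 Hg] := (vordS N g).1 H.
rewrite !viterS vfieldM viterD evD (IH f _ Hg).
by rewrite (vordMl (vfield f) H) // add0r.
Qed.

Lemma vord_const N f : vfield f = 0 -> ev f p = 0 -> vord N f.
Proof. by move=> f0 fp [|j] _ //; rewrite viterS f0 viter0 ev0. Qed.

Lemma vord_rdvd N f g : vfield f = 0 -> ev f p = 0 -> rdvd f g -> vord N g.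
Proof. by move=> f0 fp [c ->]; apply: vordMl; exact: vord_const. Qed.

Lemma vord_mp N g : mp p N g -> vord N g.
Proof.
elim: N g => [//|N IH] g gN; apply/vordS; split; first by apply: mp1_ev; exact: mp_leq gN.
apply: IH; have iN := ideal_mp p N; rewrite /vfield; apply: (ideal_sum _ iN) => l _.
by case: iN => _ _; apply; exact: mp_mderiv.
Qed.

Lemma vfieldXn f n : vfield (f ^+ n.+1) = n.+1%:R * vfield f * f ^+ n.
Proof.
elim: n => [|n IH]; first by rewrite expr1 expr0 mulr1 mul1r.
by rewrite exprS vfieldM IH -[in RHS]natr1 exprS; ring.
Qed.

Lemma viter_exp d f : ev f p = 0 ->
  ev (viter d (f ^+ d)) p = d`!%:R * ev (vfield f) p ^+ d.
Proof.
move=> f0; have f1 : mp p 1 f by exact: mp1P.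
have fd n : vord n (f ^+ n).
  by apply: vord_mp; exact: mp_exp.
elim: d => [|d IH]; first by rewrite !expr0 ev1 mulr1.
rewrite viterS vfieldXn viter_lead // IH evM -mpolyC_nat evC factS natrM exprS.
by ring.
Qed.

End Derivations.

(** * Powers of the maximal ideal along a curve *)

Section LocalGrowth.
Variable K : numClosedFieldType.
Local Notation P := {mpoly K[3]}.
Local Notation pt := 'rV[K]_3.
Variable p : pt.
Implicit Types (f g h : P) (I J : P -> Prop).

Lemma mp_generators N : exists (T : finType) (u : T -> P), (forall t, mp p N (u t)) /\
  forall g, mp p N.+1 g -> exists c : T -> P, (forall t, ev (c t) p = 0) /\ g = \sum_t c t * u t.
Proof.
elim: N => [|N [T [u [uN span]]]].
  exists unit, (fun=> 1); split=> // g /mp1_ev g0; exists (fun=> g); split=> //.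
  by rewrite (bigD1 tt) //= big1 ?addr0 ?mulr1 // => -[].
exists ('I_3 * T)%type, (fun x => shX p x.1 * u x.2); split=> [[l t]|g [h [hN ->]]].
  exact: mp_mul (mp_shX p l) (uN t).
pose c l := projT1 (cid (span _ (hN l))).
have cP l : (forall t, ev (c l t) p = 0) /\ h l = \sum_t c l t * u t by rewrite /c; case: cid.
exists (fun x => c x.1 x.2); split=> [[l t]|]; first exact: (cP l).1.
rewrite -(pair_bigA _ (fun l t => c l t * (shX p l * u t))) /=; apply: eq_bigr => l _.
rewrite (cP l).2 mulr_sumr; apply: eq_bigr => t _; exact: mulrCA.
Qed.

(* Nakayama's lemma, by the determinant trick. *)
Lemma mp_strict I N l : prime_ideal I -> (forall g, I g -> ev g p = 0) -> ~ I (shX p l) ->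
  ~ (forall g, mp p N g -> subsum I (mp p N.+1) g).
Proof.
move=> [iI I1 IP] Ip nl sub; have [T [u [uN span]]] := mp_generators N.
have rel t : exists c : T -> P, (forall s, ev (c s) p = 0) /\ I (u t - \sum_s c s * u s).
  have [i [g [Ii /span[c [c0 eg]] eu]]] := sub _ (uN t).
  by exists c; rewrite eu -eg addrK.
pose c t := projT1 (cid (rel t)).
have c0 t s : ev (c t s) p = 0 by rewrite /c; case: cid => ? [].
have cI t : I (u t - \sum_s c t s * u s) by rewrite /c; case: cid => ? [].
pose M : 'M[P]_#|T| := \matrix_(i, j) ((i == j)%:R - c (enum_val i) (enum_val j)).
pose U : 'cV[P]_#|T| := \col_i u (enum_val i).
have MU i : (M *m U) i 0 = u (enum_val i) - \sum_s c (enum_val i) s * u s.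
  rewrite mxE; under eq_bigr do rewrite !mxE mulrBl; rewrite sumrB; congr (_ - _).
    by rewrite (bigD1 i) //= eqxx mul1r big1 ?addr0 // => j; rewrite eq_sym => /negPf->; rewrite mul0r.
  by rewrite [RHS](reindex (fun j : 'I_#|T| => enum_val j)) //; apply: onW_bij; exact: enum_val_bij.
have dM : ~ I (\det M).
  move/Ip; rewrite /ev -(det_map_mx (meval (fun j => p 0 j))).
  have -> : map_mx (meval (fun j => p 0 j)) M = 1%:M.
    apply/matrixP => i j; rewrite !mxE mevalB -[meval _ (c _ _)]/(ev _ p) c0 subr0.
    by case: (i == j); rewrite ?meval1 ?meval0.
  by rewrite det1 => /eqP; rewrite oner_eq0.
have uI t : I (u t).
  suff : I (\det M * u t) by case/IP.
  have -> : \det M * u t = (\adj M *m (M *m U)) (enum_rank t) 0.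
    by rewrite mulmxA mul_adj_mx mul_scalar_mx !mxE enum_rankK.
  rewrite mxE; apply: (ideal_sum _ iI) => j _; rewrite MU.
  by case: (iI) => _ _; apply; exact: cI.
have expl n : I (shX p l ^+ n) -> I (shX p l).
  by elim: n => [//|n IH]; rewrite exprS => /IP[].
apply: nl; apply: (expl N.+1).
have : mp p N.+1 (shX p l ^+ N.+1) by exact/mp_exp/mp_shX.
move/span => [d [_ ->]]; apply: (ideal_sum _ iI) => t _.
by case: (iI) => _ _; apply.
Qed.

(** The powers of the maximal ideal decrease strictly modulo [I], and each step adds one to the
    codimension. *)
Lemma local_dim I N l : prime_ideal I -> (forall g, I g -> ev g p = 0) -> ~ I (shX p l) ->
  dim_ge (fun _ => True) (subsum I (mp p N)) N.
Proof.
move=> pI Ip nl; have [iI _ _] := pI; elim: N => [|N IH]; first exact: dim_ge0.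
have [u [uN nu]] : exists u, mp p N u /\ ~ subsum I (mp p N.+1) u.
  apply: contrapT => H; apply: (mp_strict (N := N) pI Ip nl) => g gN.
  by apply: contrapT => ng; apply: H; exists g.
have iS M := ideal_subsum iI (ideal_mp p M).
have ge1 : dim_ge (mp p N) (subsum I (mp p N.+1)) 1.
  exists (fun=> u); split=> // c; rewrite big_ord1 => cu i; rewrite (ord1 i).
  apply: contrapT => /eqP c0; apply: nu.
  rewrite -[u]scale1r -(mulVf c0) -scalerA.
  by case: (ideal_subsp (iS N.+1)) => _ _; apply.
rewrite -[X in dim_ge _ _ X]addn1; apply: dim_geS (dim_ge_cat _ (ideal_subsp (iS N)) IH ge1) => //.
  move=> x [a [b [Ia mb ->]]]; split; exists a, b; split=> //; exact: mpW.
by move=> x mx; split=> //; apply: subsumr mx; exact: ideal_subsp.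
Qed.

End LocalGrowth.

(** * Several curves through a point; leading forms on a smooth surface *)

Section LocalSurface.
Variable K : numClosedFieldType.
Local Notation P := {mpoly K[3]}.
Local Notation pt := 'rV[K]_3.
Variable p : pt.
Implicit Types (f g h Q : P) (A : cset K).

(** For a new curve [A], let [Q], of degree at most [T e], vanish on the previous curves and not on
    [A]. Its multiples lie in the previous ideals, yet on [A] they fill all but [32 e^2 T e] of the
    [N] dimensions. *)
Lemma curves_local_dim e T N (gs : seq (cset K)) : (0 < e)%N -> (size gs <= T)%N ->
    distinct_sets gs ->
    (forall i, (i < size gs)%N -> Ecurve e (nth (@cset0 K) gs i) /\ nth (@cset0 K) gs i p) ->
  dim_ge (fun _ => True)
    (fun g => forall i, (i < size gs)%N -> subsum (Iof (nth (@cset0 K) gs i)) (mp p N) g)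
    (size gs * (N - 32 * (e * e) * (T * e))).
Proof.
move=> e0; elim: gs => [|A gs IH] sT dis cgs; first exact: dim_ge0.
set k := (N - _)%N.
have dis' : distinct_sets gs by move=> i j ig jg ij; apply: (dis i.+1 j.+1).
have cgs' i : (i < size gs)%N -> Ecurve e (nth (@cset0 K) gs i) /\ nth (@cset0 K) gs i p.
  by move=> ig; apply: (cgs i.+1).
have {}IH := IH (ltnW sT) dis' cgs'.
have [cA Ap] : Ecurve e A /\ A p by exact: (cgs 0%N).
have pI := irr_curve_prime cA.1; have [iI I1 IP] := pI.
have [Q [bQ Qgs QA]] : exists Q, [/\ box (T * e).+1 Q,
    forall i, (i < size gs)%N -> Iof (nth (@cset0 K) gs i) Q & ~ Iof A Q].
  have sep (i : 'I_(size gs)) : exists q, [/\ (msize q <= e.+1)%N,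
      Iof (nth (@cset0 K) gs i) q & ~ Iof A q].
    apply: (Ecurve_separate (cgs' i (ltn_ord i)).1 cA) => eq.
    by apply: (dis i.+1 0%N) => //; exact: (ltn_ord i).
  exists (\prod_i projT1 (cid (sep i))); split=> [|i ig x Ax|].
  - have : box (size gs * e).+1 (\prod_i projT1 (cid (sep i))).
      rewrite -[X in (X * e)%N]card_ord -sum1_card big_distrl /=.
      apply: (big_ind2 (fun (Q : P) n => box n.+1 Q)) => [|a n b m bn bm|i _].
      + by rewrite -(mpolyC1 3); exact: boxC.
      + by rewrite -addnS; exact: boxM.
      + by rewrite mul1n; case: cid => q /= [? _ _]; exact: box_msize.
    by apply: box_leq; rewrite ltnS leq_mul2r ltnW ?orbT.
  - rewrite ev_prod (bigD1 (Ordinal ig)) //=.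
    by case: cid => q /= [_ Iq _]; rewrite Iq ?mul0r.
  - apply: (big_ind (fun Q => ~ Iof A Q)); first exact: I1.
      by move=> a b na nb /IP[].
    by move=> i _; case: cid => q /= [].
have iJA := ideal_subsum iI (ideal_mp p N).
have iQ := ideal_rdvd Q.
have [l nl] := irr_curve_coord p cA.1.
have geA : dim_ge (fun _ => True) (subsum (Iof A) (mp p N)) N.
  by apply: (local_dim N pI _ nl) => g /(_ p Ap).
have leQ : dim_le (fun _ => True) (subsum (subsum (Iof A) (mp p N)) (rdvd Q)) (32 * (e * e) * (T * e)).
  apply: (@dim_leS _ _ (fun _ => True) (fun _ => True) _ (subsum (Iof A) (rdvd Q)) _ _ (leqnn _)) => //.
    by move=> _ [a [b [Aa Qb ->]]]; exists a, b; split=> //; apply: subsuml Aa; exact/ideal_subsp/ideal_mp.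
  apply: dim_dichotomy => //; first exact: ideal_subsp (ideal_subsum iI iQ).
  by move/(thin_codim pI (Ecurve_thin e0 cA) QA bQ); rewrite ltnn.
have ge2 := dim_ge_quot (ideal_subsp iJA) (ideal_subsp iQ) geA leQ.
have sJ : subsp (fun g => forall i, (i < size gs)%N -> subsum (Iof (nth (@cset0 K) gs i)) (mp p N) g).
  have iS i := ideal_subsum (ideal_Iof (nth (@cset0 K) gs i)) (ideal_mp p N).
  split=> [i _|x y Jx Jy i ig|c x Jx i ig].
  - by have [] := iS i.
  - by have [_ D _] := iS i; apply: D; [exact: Jx|exact: Jy].
  - by have [_ _ Z] := ideal_subsp (iS i); apply/Z/Jx.
rewrite /= mulSnr; apply: dim_geS (dim_ge_cat _ sJ IH ge2) => //.
  by move=> x H1; split=> [i ig|]; [exact: (H1 i.+1)|exact: (H1 0%N)].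
move=> _ [c ->]; split=> // i ig; apply: subsuml; first exact/ideal_subsp/ideal_mp.
by case: (ideal_Iof (nth (@cset0 K) gs i)) => _ _; apply; exact: Qgs.
Qed.

Variables (f : P) (i j k : 'I_3).
Hypotheses (ij : i != j) (ik : i != k) (jk : j != k).
Hypothesis ijk : forall l, [\/ l = i, l = j | l = k].
Hypotheses (fp : ev f p = 0) (fk : ev f^`M(k) p != 0).

Lemma sum_ijk (R : nmodType) (F : 'I_3 -> R) : \sum_l F l = F i + F j + F k.
Proof.
rewrite (bigD1 i) //= (bigD1 j) /=; last by rewrite eq_sym.
rewrite (bigD1 k) /=; last by rewrite ![k == _]eq_sym ik jk.
rewrite big1 ?addr0 ?addrA // => l /andP[/andP[li lj] lk].
by case: (ijk l) li lj lk => ->; rewrite eqxx.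
Qed.

Let s1 := shX p i.
Let s2 := shX p j.

(** The linear part of [f] at [p] can be solved for coordinate [k]: the implicit function theorem to
    first order. *)
Lemma third_coordinate : exists al be ga : K,
  mp p 2 (shX p k - (al *: s1 + be *: s2 + ga *: f)).
Proof.
have [h [_ eh]] := mp1P fp.
have hk : ev (h k) p = ev f^`M(k) p.
  rewrite eh mderiv_shX_sum evD ev_sum big1 ?addr0 // => l _.
  by rewrite evM ev_shX mul0r.
have hk0 : ev (h k) p != 0 by rewrite hk.
exists (- ((ev (h k) p)^-1 * ev (h i) p)), (- ((ev (h k) p)^-1 * ev (h j) p)), (ev (h k) p)^-1.
have -> : shX p k - (- ((ev (h k) p)^-1 * ev (h i) p) *: s1 +
    - ((ev (h k) p)^-1 * ev (h j) p) *: s2 + (ev (h k) p)^-1 *: f) =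
   \sum_l (- (ev (h k) p)^-1) *: (shX p l * (h l - (ev (h l) p)%:MP)).
  rewrite sum_ijk [in LHS]eh sum_ijk -!mul_mpolyC !mpolyCN !mpolyCM -/s1 -/s2.
  have e1 : (ev (h k) p)^-1%:MP * (ev (h k) p)%:MP = 1 :> P by rewrite -mpolyCM mulVf.
  by rewrite -{1}[shX p k]mul1r -e1; ring.
apply: (ideal_sum _ (ideal_mp p 2)) => l _.
have [_ _ Z] := ideal_subsp (ideal_mp p 2); apply: Z.
exact: mp_mul (mp_shX p l) (mp1_sub_ev p (h l)).
Qed.

(** A binary form stored as its dehomogenization, so that its restriction to the direction
    [s2 = be s1] is read off from [q.[be]]. *)
Definition form d (q : {poly K}) : P := \sum_(a < d.+1) q`_a *: (s1 ^+ (d - a) * s2 ^+ a).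

Lemma formD d q r : form d (q + r) = form d q + form d r.
Proof. by rewrite -big_split /=; apply: eq_bigr => a _; rewrite coefD scalerDl. Qed.

Lemma formZ d c q : form d (c *: q) = c *: form d q.
Proof. by rewrite scaler_sumr; apply: eq_bigr => a _; rewrite coefZ scalerA. Qed.

Lemma form_s1 d (q : {poly K}) : (size q <= d.+1)%N -> s1 * form d q = form d.+1 q.
Proof.
move=> sq; rewrite /form [RHS]big_ord_recr /= nth_default // scale0r addr0 mulr_sumr.
by apply: eq_bigr => a _; rewrite -scalerAr mulrA -exprS subSn // -ltnS.
Qed.

Lemma form_s2 d (q : {poly K}) : s2 * form d q = form d.+1 (q * 'X).
Proof.
rewrite /form [RHS]big_ord_recl /= coefMX scale0r add0r mulr_sumr.
by apply: eq_bigr => a _; rewrite coefMX /= /bump /= add1n subSS exprS -scalerAr; congr (_ *: _); ring.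
Qed.

(** [s1] and [s2] are local coordinates on [Z(f)]: [third_coordinate] trades the third one for them,
    up to higher order. *)
Lemma leading_form_mod d w : mp p d w -> exists2 q : {poly K}, (size q <= d.+1)%N &
  subsum (rdvd f) (mp p d.+1) (w - form d q).
Proof.
have [al [be [ga m2]]] := third_coordinate.
have iS n : ideal (subsum (rdvd f) (mp p n)) := ideal_subsum (ideal_rdvd f) (ideal_mp p n).
elim: d w => [|d IH] w.
  move=> _; exists (ev w p)%:P; first by rewrite (leq_trans (size_polyC_leq1 _)).
  rewrite /form big_ord1 !expr0 mulr1 coefC /= -[_ *: 1]mul_mpolyC mulr1.
  by apply: subsumr (mp1_sub_ev p w); exact/ideal_subsp/ideal_rdvd.
move=> [h [hd ->]].
have shift l g : subsum (rdvd f) (mp p d.+1) g -> subsum (rdvd f) (mp p d.+2) (shX p l * g).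
  move=> [a [b [[c ->] mb ->]]]; exists (shX p l * (c * f)), (shX p l * b).
  rewrite mulrDr; split=> //; first by rewrite mulrA; exact/rdvd_mull/rdvd_refl.
  by rewrite -[d.+2]add1n; exact: mp_mul (mp_shX p l) mb.
have H l : exists2 q : {poly K}, (size q <= d.+1)%N & subsum (rdvd f) (mp p d.+1) (h l - form d q).
  exact: IH (hd l).
have part l : exists2 q : {poly K}, (size q <= d.+2)%N &
    subsum (rdvd f) (mp p d.+2) (shX p l * h l - form d.+1 q).
  have [q sq Hq] := H l.
  have sqX : (size (q * 'X)%R <= d.+2)%N.
    by have [->|q0] := eqVneq q 0; rewrite ?mul0r ?size_poly0 // size_mulX.
  have sqW : (size q <= d.+2)%N by exact: leqW.
  have := shift l _ Hq; rewrite mulrBr => Hl.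
  have [e|e|e] := ijk l.
  - by exists q => //; rewrite -form_s1 // /s1 -e.
  - by exists (q * 'X) => //; rewrite -form_s2 // /s2 -e.
  exists (al *: q + be *: (q * 'X)).
    rewrite (leq_trans (size_polyD _ _)) // geq_max.
    by rewrite !(leq_trans (size_scale_leq _ _)).
  rewrite formD !formZ -form_s1 // -form_s2.
  have -> : shX p l * h l - (al *: (s1 * form d q) + be *: (s2 * form d q)) =
     (shX p l * h l - shX p l * form d q) +
     (ga%:MP * form d q * f + (shX p k - (al *: s1 + be *: s2 + ga *: f)) * form d q).
    by rewrite e -!mul_mpolyC; ring.
  have [_ ID _] := iS d.+2; apply: ID => //.
  exists (ga%:MP * form d q * f), ((shX p k - (al *: s1 + be *: s2 + ga *: f)) * form d q).
  split=> //; first exact/rdvd_mull/rdvd_refl.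
  rewrite -[d.+2]add2n; apply: mp_mul => //.
  apply: (ideal_sum _ (ideal_mp p d)) => a _.
  have [_ _ Z] := ideal_subsp (ideal_mp p d); apply: Z.
  have ad : (a <= d)%N by rewrite -ltnS.
  by rewrite -[X in mp p X _](subnK ad); apply: mp_mul; exact/mp_exp/mp_shX.
pose q l := sval (cid2 (part l)).
have qs l : (size (q l) <= d.+2)%N by rewrite /q; case: cid2.
have qP l : subsum (rdvd f) (mp p d.+2) (shX p l * h l - form d.+1 (q l)).
  by rewrite /q; case: cid2.
exists (q i + q j + q k).
  by rewrite !(leq_trans (size_polyD _ _)) // !geq_max !(leq_trans (size_polyD _ _)) ?geq_max ?qs.
rewrite sum_ijk !formD.
have -> : forall a b c a' b' c' : P, a + b + c - (a' + b' + c') = (a - a') + (b - b') + (c - c').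
  by move=> *; ring.
by have [_ ID _] := iS d.+2; exact: (ID _ _ (ID _ _ (qP i) (qP j)) (qP k)).
Qed.

End LocalSurface.

(** * Lengths on a smooth surface germ *)

Section LocalIntersection.
Variable K : numClosedFieldType.
Local Notation P := {mpoly K[3]}.
Local Notation pt := 'rV[K]_3.
Variables (p : pt) (f : P) (i j k : 'I_3).
Hypotheses (ij : i != j) (ik : i != k) (jk : j != k).
Hypothesis ijk : forall l, [\/ l = i, l = j | l = k].
Hypotheses (fp : ev f p = 0) (fk : ev f^`M(k) p != 0).
Implicit Types (g h Q w : P) (be : K).

Let s1 := shX p i.
Let s2 := shX p j.
(** A plane through [p]. It cuts [Z(f)] in a smooth germ with parameter [s1]; orders on the surface
    are read on these sections. *)
Let u be := s2 - be *: s1.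
Let J0 be := subsum (rdvd f) (rdvd (u be)).

Let iJ0 be : ideal (J0 be).
Proof. exact: ideal_subsum (ideal_rdvd f) (ideal_rdvd (u be)). Qed.

Lemma form_mod_u d be (q : {poly K}) : (size q <= d.+1)%N ->
  rdvd (u be) (form p i j d q - q.[be] *: s1 ^+ d).
Proof.
move=> sq; rewrite (horner_coef_wide _ sq) scaler_suml -sumrB.
apply: rdvd_sum => a _; rewrite -scalerA -scalerBr -mul_mpolyC; apply: rdvd_mull.
have ad : (a <= d)%N by rewrite -ltnS.
have -> : s1 ^+ d = s1 ^+ (d - a) * s1 ^+ a by rewrite -exprD subnK.
rewrite scalerAr -mulrBr -exprZn -/s1 -/s2 subrXX; apply: rdvd_mull.
exact/rdvd_mulr/rdvd_refl.
Qed.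

Lemma lead_u d be w (q : {poly K}) : (size q <= d.+1)%N ->
    subsum (rdvd f) (mp p d.+1) (w - form p i j d q) ->
  subsum (J0 be) (mp p d.+1) (w - q.[be] *: s1 ^+ d).
Proof.
move=> sq [a [b [fa mb e]]].
exists (a + (form p i j d q - q.[be] *: s1 ^+ d)), b; split=> //.
  by exists a, (form p i j d q - q.[be] *: s1 ^+ d); split=> //; exact: form_mod_u.
by rewrite addrAC -e addrA subrK.
Qed.

Lemma lead_u_ex d be w : mp p d w -> exists c, subsum (J0 be) (mp p d.+1) (w - c *: s1 ^+ d).
Proof.
move=> /(leading_form_mod ij ik jk ijk fp fk)[q sq H].
by exists q.[be]; exact: lead_u.
Qed.

(* The vector field is tangent to the curve cut out by [f] and [u be]. *)
Lemma s1_exp_free d be c : subsum (J0 be) (mp p d.+1) (c *: s1 ^+ d) -> c = 0.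
Proof.
move=> [_ [b [[x [y [fx uy ->]]] mb e]]].
pose a l : P := if l == i then f^`M(k) else if l == j then be *: f^`M(k)
  else - (f^`M(i) + be *: f^`M(j)).
have ai : a i = f^`M(k) by rewrite /a eqxx.
have aj : a j = be *: f^`M(k) by rewrite /a eq_sym (negPf ij) eqxx.
have ak : a k = - (f^`M(i) + be *: f^`M(j)).
  by rewrite /a ![k == _]eq_sym (negPf ik) (negPf jk).
have af : vfield a f = 0.
  rewrite /vfield (sum_ijk ij ik jk ijk) ai aj ak -!mul_mpolyC; ring.
have as1 : vfield a s1 = f^`M(k).
  rewrite /vfield (sum_ijk ij ik jk ijk) ai aj ak !mderiv_shX eqxx (negPf ij) (negPf ik).
  by rewrite mulr1 !mulr0 !addr0.
have as2 : vfield a s2 = be *: f^`M(k).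
  rewrite /vfield (sum_ijk ij ik jk ijk) ai aj ak !mderiv_shX eqxx eq_sym (negPf ij) (negPf jk).
  by rewrite mulr1 !mulr0 addr0 add0r.
have au : vfield a (u be) = 0.
  by rewrite /u vfieldD -scaleN1r scalerA mulN1r !vfieldZ as1 as2 scaleNr subrr.
have up : ev (u be) p = 0 by rewrite /u evB evZ !ev_shX mulr0 subrr.
have : vord a p d.+1 (c *: s1 ^+ d).
  rewrite e; apply: vordD; last exact: vord_mp.
  by apply: vordD; [exact: (vord_rdvd af fp fx)|exact: (vord_rdvd au up uy)].
move/(_ d (ltnSn d)); rewrite viterZ evZ viter_exp ?ev_shX // as1 => /eqP.
rewrite !mulf_eq0 expf_eq0 (negPf fk) andbF orbF pnatr_eq0 eqn0Ngt fact_gt0 orbF.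
by move/eqP.
Qed.

Lemma span_s1 be N g : exists c : 'I_N -> K,
  subsum (J0 be) (mp p N) (g - \sum_(l < N) c l *: s1 ^+ l).
Proof.
elim: N => [|N [c [a [b [Ja mb e]]]]].
  by exists (fun=> 0); apply: subsumr => //; exact/ideal_subsp/iJ0.
have [d Hd] := lead_u_ex be mb.
exists (fun l => if unlift ord_max l is Some l' then c l' else d).
rewrite big_ord_recr /= unlift_none opprD addrA.
have -> : \sum_(l < N) (if unlift ord_max (widen_ord (leqnSn N) l) is Some l' then c l' else d) *: s1 ^+ l
   = \sum_(l < N) c l *: s1 ^+ l.
  apply: eq_bigr => l _; congr (_ *: _).
  have -> : widen_ord (leqnSn N) l = lift ord_max l by apply: val_inj; rewrite [RHS]lift_max.
  by rewrite liftK.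
rewrite e -addrA; have [_ ID _] := ideal_subsum (iJ0 be) (ideal_mp p N.+1).
by apply: ID => //; apply: subsuml Ja; exact/ideal_subsp/ideal_mp.
Qed.

(** Multiplication by [v] maps the quotient for [v ^+ n] onto the multiples of [v] in the quotient
    for the next power, so each power costs at most [o]. *)
Lemma dim_le_power (L : P -> Prop) v o n : ideal L ->
  dim_le (fun _ => True) (subsum L (rdvd v)) o ->
  dim_le (fun _ => True) (subsum L (rdvd (v ^+ n))) (o * n).
Proof.
move=> iL le1; elim: n => [|n IH].
  rewrite muln0; exists (fun=> 0) => g _; exists (fun=> 0).
  rewrite expr0 big_ord0 subr0; apply: subsumr; first exact: ideal_subsp.
  by exists g; rewrite mulr1.
have iLn := ideal_subsum iL (ideal_rdvd (v ^+ n.+1)).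
rewrite mulnS; apply: dim_le_trans le1 _; first exact: ideal_subsp.
have [s span] := IH; exists (fun l => v * s l) => _ [a [_ [La [x ->] ->]]].
have [//|c [a' [_ [La' [y ->] e]]]] := span x; exists c.
exists (a + a' * v), (y * v ^+ n.+1); split.
- by case: iL => _ ID IM; apply: ID => //; rewrite mulrC; exact: IM.
- exact/rdvd_mull/rdvd_refl.
have -> : \sum_l c l *: (v * s l) = v * \sum_l c l *: s l.
  by rewrite mulr_sumr; apply: eq_bigr => l _; rewrite scalerAr.
have -> : x = \sum_l c l *: s l + (a' + y * v ^+ n) by rewrite -e addrC subrK.
by rewrite exprS; ring.
Qed.

(** Let [o] be the order of [Q] on the section. Modulo [f], [Q] and [u be], the power [s1 ^+ o] is
    pushed to arbitrarily high order, which leaves at most [o] dimensions. Replacing [u be] by its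
    [N]-th power, already in [mp p N], multiplies this by [N]. *)
Lemma section_dim T N Q be : ~ subsum (J0 be) (mp p T) Q -> exists2 o, (o < T)%N &
  dim_le (fun _ => True) (subsum (subsum (rdvd f) (rdvd Q)) (mp p N)) (o * N).
Proof.
move=> nQ; have iS n := ideal_subsum (iJ0 be) (ideal_mp p n).
have [o oT [[x [w [Jx mw eQ]]] nQo]] : exists2 o, (o < T)%N &
    subsum (J0 be) (mp p o) Q /\ ~ subsum (J0 be) (mp p o.+1) Q.
  elim: T nQ => [|T IH] nQ.
    by case: nQ; apply: subsumr => //; exact/ideal_subsp/iJ0.
  have [HT|/IH[o oT H]] := pselect (subsum (J0 be) (mp p T) Q); first by exists T.
  by exists o => //; exact: leqW.
exists o => //; pose L1 := subsum (J0 be) (rdvd Q).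
have iL1 : ideal L1 := ideal_subsum (iJ0 be) (ideal_rdvd Q).
have iZ n := ideal_subsum iL1 (ideal_mp p n).
have JZ n g : subsum (J0 be) (mp p n) g -> subsum L1 (mp p n) g.
  move=> [a [b [Ja mb ->]]]; exists a, b; split=> //.
  by apply: subsuml Ja; exact/ideal_subsp/ideal_rdvd.
have LZ n g : L1 g -> subsum L1 (mp p n) g.
  by move=> H; apply: subsuml H; exact/ideal_subsp/ideal_mp.
have [c Hc] := lead_u_ex be mw.
have c0 : c != 0.
  apply: contra_not_neq nQo => c0; rewrite eQ; have [_ ID _] := iS o.+1.
  apply: ID; first by apply: subsuml Jx; exact/ideal_subsp/ideal_mp.
  by move: Hc; rewrite c0 scale0r subr0.
have s1Z : subsum L1 (mp p o.+1) (s1 ^+ o).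
  have sZ := ideal_subsp (iZ o.+1); have [_ ZD ZZ] := sZ.
  rewrite -[s1 ^+ o]scale1r -(mulVf c0) -scalerA; apply: ZZ.
  have -> : c *: s1 ^+ o = Q - x - (w - c *: s1 ^+ o) by rewrite eQ; ring.
  apply: (subspB sZ); last exact: JZ.
  apply: (subspB sZ); apply: LZ.
    by apply: subsumr; [exact/ideal_subsp/iJ0|exact: rdvd_refl].
  by apply: subsuml Jx; exact/ideal_subsp/ideal_rdvd.
have step m g : mp p (o + m) g -> subsum L1 (mp p (o + m).+1) g.
  elim: m g => [|m IH] g.
    rewrite addn0 => /(lead_u_ex be)[d Hd]; have [_ ZD ZZ] := ideal_subsp (iZ o.+1).
    by rewrite -[g](subrK (d *: s1 ^+ o)); apply: ZD; [exact: JZ|exact: ZZ].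
  rewrite addnS => -[h [hm ->]]; apply: (ideal_sum _ (iZ _)) => l _.
  have [a [b [La mb ->]]] := IH _ (hm l); exists (shX p l * a), (shX p l * b).
  split; last exact: mulrDr.
    by case: iL1 => _ _; apply.
  by rewrite -[(o + m).+2]add1n; exact: mp_mul (mp_shX p l) mb.
have climb m g : mp p o g -> subsum L1 (mp p (o + m)) g.
  elim: m g => [|m IH] g mg.
    by rewrite addn0; apply: subsumr mg; exact: ideal_subsp.
  have [a [b [La /step mb ->]]] := IH g mg; rewrite addnS.
  by have [_ ID _] := iZ (o + m).+1; apply: ID => //; exact: LZ.
pose L := subsum (subsum (rdvd f) (rdvd Q)) (mp p N).
have iL : ideal L := ideal_subsum (ideal_subsum (ideal_rdvd f) (ideal_rdvd Q)) (ideal_mp p N).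
have le1 : dim_le (fun _ => True) (subsum L (rdvd (u be))) o.
  exists (fun l => s1 ^+ l) => g _; have [d [a [b [Ja mb e]]]] := span_s1 be o g; exists d.
  have [a' [b' [[_ [y [[x1 [x2 [fx1 ux2 ->]]] Qy ->]]] mb' e']]] := climb N b mb.
  have {ux2} : J0 be (a + (x1 + x2)).
    by have [_ JD _] := iJ0 be; apply: JD => //; exists x1, x2.
  rewrite e => -[z1 [z2 [fz1 uz2 ez]]].
  exists (z1 + y + b'), z2; split=> //.
    exists (z1 + y), b'; split=> //; first by exists z1, y.
    by apply: mp_leq mb'; rewrite leq_addl.
  by transitivity (a + (x1 + x2) + y + b'); [rewrite e'; ring|rewrite ez; ring].
have := dim_le_power N iL le1; apply: dim_leS => // _ [a [_ [La [b ->] ->]]].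
have [_ LD LM] := iL; apply: LD => //; apply: LM; apply: subsumr.
  exact/ideal_subsp/ideal_subsum/ideal_rdvd/ideal_rdvd.
have um : mp p 1 (u be) by apply: mp1P; rewrite /u evB evZ !ev_shX mulr0 subrr.
exact: mp_exp.
Qed.

(** The leading form of [Q] on the surface vanishes in every direction [be], and a nonzero
    polynomial has a nonroot. *)
Lemma mem_of_sections d Q : (forall be, subsum (J0 be) (mp p d) Q) -> subsum (rdvd f) (mp p d) Q.
Proof.
have iF n := ideal_subsum (ideal_rdvd f) (ideal_mp p n).
elim: d => [|d IH] H.
  by apply: subsumr => //; exact/ideal_subsp/ideal_rdvd.
have [|a [w [fa mw eQ]]] := IH.
  by move=> be; have [a [b [Ja mb ->]]] := H be; exists a, b; split=> //; exact: mpW.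
have [q sq Hq] := leading_form_mod ij ik jk ijk fp fk mw.
suff q0 : q = 0.
  have [_ ID _] := iF d.+1; rewrite eQ; apply: ID.
    by apply: subsuml fa; exact/ideal_subsp/ideal_mp.
  move: Hq; rewrite q0 /form big1 ?subr0 // => b _.
  by rewrite coef0 scale0r.
apply: contrapT => /eqP/closed_nonrootP[be]; rewrite /root => /eqP; apply.
apply: (@s1_exp_free d be).
have sZ := ideal_subsp (ideal_subsum (iJ0 be) (ideal_mp p d.+1)).
have -> : q.[be] *: s1 ^+ d = Q - a - (w - q.[be] *: s1 ^+ d) by rewrite eQ; ring.
apply: (subspB sZ); last exact: lead_u.
apply: (subspB sZ) => //; apply: subsuml; first exact/ideal_subsp/ideal_mp.
by apply: subsuml fa; exact/ideal_subsp/ideal_rdvd.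
Qed.

(** Put [T = size gs]. If [Q] had order [o < T] on a section, the curves would give
    [T (N - kap) <= o N <= (T - 1) N], with [kap] the loss per curve; this fails for [N > T kap]. *)
Lemma local_membership e N Q (gs : seq (cset K)) : (0 < e)%N ->
    (size gs * (32 * (e * e) * (size gs * e)) < N)%N ->
    distinct_sets gs ->
    (forall l, (l < size gs)%N -> Ecurve e (nth (@cset0 K) gs l) /\ nth (@cset0 K) gs l p) ->
    (forall l, (l < size gs)%N -> subsum (Iof (nth (@cset0 K) gs l)) (mp p N) f) ->
    (forall l, (l < size gs)%N -> subsum (Iof (nth (@cset0 K) gs l)) (mp p N) Q) ->
  subsum (rdvd f) (mp p (size gs)) Q.
Proof.
move=> e0 TN dis cgs fgs Qgs; apply: mem_of_sections => be; apply: contrapT => nQ.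
have [o oT le1] := section_dim N nQ.
have := dim_geS (leqnn _) (fun _ _ => Logic.I) _ (curves_local_dim N e0 (leqnn _) dis cgs).
move/(_ (subsum (subsum (rdvd f) (rdvd Q)) (mp p N))) => ge1.
have iL : ideal (subsum (subsum (rdvd f) (rdvd Q)) (mp p N)).
  exact: ideal_subsum (ideal_subsum (ideal_rdvd f) (ideal_rdvd Q)) (ideal_mp p N).
have : (size gs * (N - 32 * (e * e) * (size gs * e)) <= o * N)%N.
  apply: (dim_ge_leq (ideal_subsp iL) _ le1); apply: ge1 => _ [_ [b [[_ [_ [[x ->] [y ->] ->]]] mb ->]]] l lg.
  have iI := ideal_subsum (ideal_Iof (nth (@cset0 K) gs l)) (ideal_mp p N).
  have mbI := subsumr (ideal_subsp (ideal_Iof (nth (@cset0 K) gs l))) mb.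
  have [_ ID IM] := iI; exact: (ID _ _ (ID _ _ (IM _ _ (fgs l lg)) (IM _ _ (Qgs l lg))) mbI).
move: TN oT; set kap := (32 * _ * _)%N; rewrite mulnBr; case: (size gs) => // T.
rewrite ltnS => TN oT; rewrite leqNgt => /negP; apply.
have : (o * N <= T * N)%N by rewrite leq_mul2r oT orbT.
by move: TN; rewrite [(T.+1 * N)%N]mulSn; lia.
Qed.

End LocalIntersection.

(** * Integral curves and the Wronskian *)

Section SurfaceIdeal.
Variable K : numClosedFieldType.
Local Notation P := {mpoly K[3]}.
Local Notation pt := 'rV[K]_3.
Implicit Types (f g h Q : P) (J : P -> Prop).

Lemma noX_subsp k : subsp (noX (K := K) k).
Proof.
split=> [m|x y nx ny m|c x nx m]; first by rewrite msupp0.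
  by move/msuppD_le; rewrite mem_cat => /orP[/nx|/ny].
by move/msuppZ_le/nx.
Qed.

(* An ideal containing no polynomial in two of the variables has codimension
   growing quadratically. *)
Lemma thin_eliminates J c k : thin J c -> ideal J -> exists h, [/\ noX k h, J h & h <> 0].
Proof.
move=> [c0 thinJ] iJ; apply: contrapT => H.
have HJ h : noX k h -> J h -> h = 0.
  by move=> nh Jh; apply: contrapT => h0; apply: H; exists h.
have [i [j [ij ik jk _]]] := other_var k.
(* The [33^2 c^2] monomials in two variables outnumber the [32 c^2] times 33 dimensions that [thin]
   allows. *)
pose e := (c * 33)%N; pose mon (w : 'I_e * 'I_e) : 'X_{1..3} := (U_(i) *+ w.1 + U_(j) *+ w.2)%MM.
have monE w l : mon w l = ((i == l) * w.1 + (j == l) * w.2)%N.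
  by rewrite mnmDE !mulmnE !mnm1E.
have mon_inj : injective mon.
  move=> [a b] [a' b'] E; have := congr1 (fun m : 'X_{1..3} => m i) E.
  have := congr1 (fun m : 'X_{1..3} => m j) E; rewrite !monE /= !eqxx (negPf ij) eq_sym (negPf ij).
  rewrite !mul1n !mul0n !addn0 !add0n => e1 e2.
  by congr (_, _); exact: val_inj.
have ge : dim_ge (box e) J (e * e).
  have -> : (e * e)%N = #|{: 'I_e * 'I_e}| by rewrite card_prod card_ord.
  apply: (dim_ge_fin (s := fun w => 'X_[mon w])) => [w m|x].
    rewrite msuppX inE => /eqP-> l; rewrite monE; case: eqP => [<-|_].
      by rewrite eq_sym (negPf ij) mul0n addn0 mul1n ltn_ord.
    by case: eqP => _; rewrite ?mul1n ?mul0n ?add0n ?ltn_ord // muln_gt0 c0.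
  move/HJ => H0 w; have {H0} := H0 _; set h := \sum_w _ => H0.
  have h0 : h = 0.
    apply: H0; have [n0 nD nZ] := noX_subsp k.
    rewrite /h; apply: (big_ind (noX k)) => // w' _; apply: nZ => m; rewrite msuppX inE => /eqP->.
    by rewrite monE (negPf ik) (negPf jk).
  have := congr1 (mcoeff (mon w)) h0; rewrite mcoeff0 /h raddf_sum (bigD1 w) //=.
  rewrite mcoeffZ mcoeffX eqxx mulr1 big1 ?addr0 // => w' ww'.
  by rewrite mcoeffZ mcoeffX (inj_eq mon_inj) (negPf ww') mulr0.
by have := thinJ _ _ ge; rewrite /e; nia.
Qed.

Lemma prime_var f : prime_elt f -> exists k m, m \in msupp f /\ m k != 0%N.
Proof. by case=> /eqP f0 f1 _; exact: nonconst_var. Qed.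

(** Otherwise the ideal of [Z(f)] would be thin and contain a nonzero polynomial without [X_k],
    although [Z(f)] projects densely along that coordinate. *)
Lemma surface_nullstellensatz f g : prime_elt f -> (forall x, ev f x = 0 -> ev g x = 0) -> rdvd f g.
Proof.
move=> pf fg; apply: contrapT => nfg; have [k [m [mf mk]]] := prime_var pf.
have th : thin (Iof (Zf f)) ((maxn 1 (msize f)) * (maxn 1 (msize g))).
  apply: thinS (thin_pair pf nfg _ _ _ _); rewrite ?leq_maxl //.
  - by move=> _ [_ [_ [[c ->] [d ->] ->]]] x fx; rewrite evD !evM fx (fg x fx) !mulr0 addr0.
  - by apply: box_msize; rewrite leqW // leq_maxr.
  - by apply: box_msize; rewrite leqW // leq_maxr.
have [h [nh Jh /eqP h0]] := thin_eliminates k th (ideal_Iof _).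
by have [x [fx /eqP]] := surface_nonvanish mf mk h0 nh; apply; exact: Jh.
Qed.

Lemma box_solve d s (L : 'I_s -> P -> K) :
    (forall l (c : {ffun 'I_3 -> 'I_d} -> K),
      L l (\sum_w c w *: 'X_[ffmon w]) = \sum_w c w * L l 'X_[ffmon w]) ->
    (s < d ^ 3)%N ->
  exists Q, [/\ Q != 0, box d Q & forall l, L l Q = 0].
Proof.
move=> Llin; rewrite -(card_ffmon d) => sd.
pose I : finType := {ffun 'I_3 -> 'I_d}.
pose A : 'M[K]_(#|I|, s) := \matrix_(x, l) L l 'X_[ffmon (enum_val x)].
have kA : kermx A != 0.
  by rewrite kermx_eq0 /row_free ltn_eqF // (leq_ltn_trans (rank_leq_col _) sd).
case/rowV0Pn: kA => v /sub_kermxP vA v0.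
pose Q := \sum_(w : I) v 0 (enum_rank w) *: 'X_[ffmon w] : P.
exists Q; split.
- apply: contraNneq v0 => Q0; apply/eqP/rowP => x; rewrite mxE.
  have := congr1 (mcoeff (ffmon (enum_val x))) Q0; rewrite mcoeff0 /Q raddf_sum /=.
  rewrite (bigD1 (enum_val x)) //= mcoeffZ mcoeffX eqxx mulr1 enum_valK big1 ?addr0 // => w wx.
  by rewrite mcoeffZ mcoeffX (inj_eq (@ffmon_inj d)) (negPf wx) mulr0.
- have [b0 bD bZ] := @box_subsp K d; rewrite /Q; apply: (big_ind (box d)) => // w _.
  by apply: bZ; exact: box_ffmon.
move=> l; rewrite /Q Llin; move/rowP/(_ l): vA; rewrite !mxE => e; rewrite -[RHS]e.
rewrite (reindex (fun x : 'I_#|I| => enum_val x)) /=; last by apply: onW_bij; exact: enum_val_bij.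
by apply: eq_bigr => x _; rewrite enum_valK !mxE.
Qed.

End SurfaceIdeal.

(** * A vector field with dense integral curves *)

Section IntegralCurve.
Variable K : numClosedFieldType.
Local Notation P := {mpoly K[3]}.
Local Notation pt := 'rV[K]_3.
Variables (f : P) (i j k : 'I_3).
Hypotheses (ij : i != j) (ik : i != k) (jk : j != k).
Hypothesis ijk : forall l, [\/ l = i, l = j | l = k].
Implicit Types (g h Q : P) (p : pt).

(* [X g = f_k * D g - D f * g_k] with [D = x_i d/dx_i + 'i x_j d/dx_j]: it kills [f],
   and [D] has distinct eigenvalues on the monomials in [x_i], [x_j], so its
   integral curves are Zariski dense in [Z(f)]. *)
Definition transverse_field (l : 'I_3) : P :=
  if l == i then f^`M(k) * 'X_i else if l == j then 'i *: (f^`M(k) * 'X_j)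
  else - (f^`M(i) * 'X_i + 'i *: (f^`M(j) * 'X_j)).

Local Notation X := (vfield transverse_field).
Local Notation Xn := (viter transverse_field).

Lemma transverse_fieldE g : X g = f^`M(k) * ('X_i * g^`M(i) + 'i *: ('X_j * g^`M(j)))
   - (f^`M(i) * 'X_i + 'i *: (f^`M(j) * 'X_j)) * g^`M(k).
Proof.
rewrite /vfield (sum_ijk ij ik jk ijk) /transverse_field eqxx eq_sym (negPf ij) eqxx.
by rewrite ![k == _]eq_sym (negPf ik) (negPf jk) -!mul_mpolyC; ring.
Qed.

Lemma transverse_field_f : X f = 0.
Proof. by rewrite transverse_fieldE -!mul_mpolyC; ring. Qed.

Definition eigval (m : 'X_{1..3}) : K := (m i)%:R + 'i * (m j)%:R.

Lemma eigval_inj (m m' : 'X_{1..3}) : m k = 0%N -> m' k = 0%N -> eigval m = eigval m' -> m = m'.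
Proof.
move=> mk mk' e; have Rn n : (n%:R : K) \is Num.real by exact: realn.
have e1 : m i = m' i.
  by have := congr1 (fun z : K => 'Re z) e; rewrite /eigval !Re_rect // => /eqP; rewrite eqr_nat => /eqP.
have e2 : m j = m' j.
  by have := congr1 (fun z : K => 'Im z) e; rewrite /eigval !Im_rect // => /eqP; rewrite eqr_nat => /eqP.
by apply/mnmP => l; case: (ijk l) => ->; rewrite // mk mk'.
Qed.

Lemma mulX_mderiv l (m : 'X_{1..3}) : 'X_l * 'X_[m]^`M(l) = (m l)%:R *: 'X_[m] :> P.
Proof.
rewrite mderivX -scalerAr -mpolyXD; have [->|ml] := eqVneq (m l) 0%N; first by rewrite !scale0r.
congr (_ *: 'X_[_]); apply/mnmP => l'; rewrite mnmDE mnmBE mnm1E.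
by case: eqP => [<-|_] /=; move: ml; lia.
Qed.

Lemma transverse_field_monomial (m : 'X_{1..3}) : m k = 0%N ->
  X 'X_[m] = f^`M(k) * (eigval m *: 'X_[m]).
Proof.
move=> mk; rewrite transverse_fieldE !mulX_mderiv mderivX mk scale0r mulr0 subr0.
by rewrite scalerA -scalerDl.
Qed.

(** Vanishing on the formal integral curve through [p]: all Taylor coefficients along the flow are
    zero. *)
Definition on_curve p g := forall N, ev (Xn N g) p = 0.

Lemma on_curve_vord p g N : on_curve p g -> vord transverse_field p N g.
Proof. by move=> H l _; exact: H. Qed.

Lemma vord_on_curve p g : (forall N, vord transverse_field p N g) -> on_curve p g.
Proof. by move=> H N; apply: (H N.+1). Qed.

Lemma ideal_on_curve p : ideal (on_curve p).
Proof.
split=> [N|x y Hx Hy N|a x Hx]; first by rewrite viter0 ev0.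
  by rewrite viterD evD Hx Hy addr0.
by apply: vord_on_curve => N; apply: vordMl; exact: on_curve_vord.
Qed.

Lemma on_curve_cancel p g h : ev g p != 0 -> on_curve p (g * h) -> on_curve p h.
Proof.
move=> g0 H; apply: vord_on_curve; elim=> [//|N IH] l; rewrite ltnS leq_eqVlt => /orP[/eqP->|]; last exact: IH.
by have := H N; rewrite viter_lead // => /eqP; rewrite mulf_eq0 (negPf g0) => /eqP.
Qed.

(** On polynomials without [X_k] the field is [D] times a factor nonzero at [p], which can be
    cancelled, so all iterates of [D] on [h] vanish at [p]. Interpolating in the distinct
    eigenvalues isolates each monomial, and none vanishes at [p]. *)
Lemma on_curve_noX p h : ev f^`M(k) p != 0 -> p 0 i != 0 -> p 0 j != 0 ->
  noX k h -> on_curve p h -> h = 0.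
Proof.
move=> fk pi pj nh Hh.
pose hN N := \sum_(m <- msupp h) (h@_m * eigval m ^+ N) *: 'X_[m] : P.
have hNc N : on_curve p (hN N).
  elim: N => [|N IH].
    suff -> : hN 0%N = h by [].
    by rewrite [RHS]mpolyE; apply: eq_bigr => m _; rewrite expr0 mulr1.
  apply: (on_curve_cancel fk).
  suff <- : X (hN N) = f^`M(k) * hN N.+1 by move=> M; rewrite -viterS; exact: IH.
  rewrite /hN vfield_sum mulr_sumr; apply: eq_big_seq => m /nh mk.
  by rewrite vfieldZ transverse_field_monomial // scalerAr scalerA exprSr mulrA.
pose y (m : 'X_{1..3}) := h@_m * \prod_l p 0 l ^+ m l.
have ysum N : \sum_(m <- msupp h) y m * eigval m ^+ N = 0.
  rewrite -[RHS](hNc N 0%N) /= /hN ev_sum; apply: eq_bigr => m _.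
  by rewrite evZ /ev mevalX /y; ring.
have yq (q : {poly K}) : \sum_(m <- msupp h) y m * q.[eigval m] = 0.
  under eq_bigr do rewrite horner_coef mulr_sumr.
  rewrite exchange_big big1 //= => l _.
  under eq_bigr do rewrite mulrCA.
  by rewrite -mulr_sumr ysum mulr0.
apply/eqP; rewrite -msupp_eq0; apply/eqP; case E: (msupp h) => [//|m0 s].
have m0h : m0 \in msupp h by rewrite E mem_head.
have := yq (\prod_(m <- msupp h | m != m0) ('X - (eigval m)%:P)).
rewrite (bigD1_seq m0) ?msupp_uniq //= [X in _ + X]big_seq_cond [X in _ + X]big1 ?addr0; last first.
  move=> m /andP[mh mm0]; rewrite horner_prod (big_rem m) //= mm0 hornerXsubC subrr.
  by rewrite mul0r mulr0.
rewrite horner_prod /y => /eqP y0; exfalso; move: y0; apply/negP; rewrite mulf_neq0 //; last first.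
  rewrite prodf_seq_neq0; apply/allP => m mh; apply/implyP => mm0.
  rewrite hornerXsubC subr_eq0; apply: contra mm0 => /eqP/esym e.
  by apply/eqP; apply: eigval_inj e; exact: nh.
rewrite mulf_neq0 -?mcoeff_msupp //; apply/prodf_neq0 => l _.
by case: (ijk l) => ->; rewrite ?(nh m0 m0h) ?expr0 ?oner_eq0 // expf_neq0.
Qed.

(* The ideal of the formal integral curve through a point is [(f)]. *)
Lemma on_curve_rdvd p g : prime_elt f -> ev f p = 0 -> ev f^`M(k) p != 0 ->
  p 0 i != 0 -> p 0 j != 0 -> on_curve p g -> rdvd f g.
Proof.
move=> pf fp fk pi pj Hg; apply: contrapT => nfg.
have iP := ideal_on_curve p; have [_ PD PM] := iP.
have Hf : on_curve p f by apply: vord_on_curve => N; exact: vord_const transverse_field_f fp.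
have th : thin (on_curve p) ((maxn 1 (msize f)) * (maxn 1 (msize g))).
  apply: thinS (thin_pair pf nfg _ _ _ _); rewrite ?leq_maxl //.
  - by move=> _ [_ [_ [[c ->] [d ->] ->]]]; exact: (PD _ _ (PM _ _ Hf) (PM _ _ Hg)).
  - by apply: box_msize; rewrite leqW // leq_maxr.
  - by apply: box_msize; rewrite leqW // leq_maxr.
have [h [nh Hh h0]] := thin_eliminates k th iP.
by apply: h0; exact: on_curve_noX nh Hh.
Qed.

End IntegralCurve.

(** * The Wronskian of a box of polynomials *)

Section Wronskian.
Variable K : numClosedFieldType.
Local Notation P := {mpoly K[3]}.
Local Notation pt := 'rV[K]_3.
Variables (f : P) (i j k : 'I_3).
Hypotheses (ij : i != j) (ik : i != k) (jk : j != k).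
Hypothesis ijk : forall l, [\/ l = i, l = j | l = k].
Hypothesis pf : prime_elt f.
Variable d : nat.
Implicit Types (g h Q : P) (p : pt).

Local Notation I := {ffun 'I_3 -> 'I_d}.
Local Notation n := #|{: I}|.
Local Notation Xn := (viter (transverse_field f i j k)).

Definition box_mon (c : 'I_n) : P := 'X_[ffmon (enum_val c)].

Definition wronskian : P := \det (\matrix_(l < n, c < n) Xn l (box_mon c)).

Lemma box_monE Q : box d Q -> Q = \sum_(c < n) Q@_(ffmon (enum_val c)) *: box_mon c.
Proof.
move=> bQ; rewrite [LHS](boxE bQ) (reindex (fun x : 'I_n => enum_val x)) //.
by apply: onW_bij; exact: enum_val_bij.
Qed.

Lemma vord_viter p l N g : vord (transverse_field f i j k) p (l + N) g ->
  vord (transverse_field f i j k) p N (Xn l g).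
Proof.
move=> H m mN; rewrite /viter -iterD; apply: H.
by rewrite addnC ltn_add2l.
Qed.

Lemma wronskian_eq0 p Q : box d Q -> Q != 0 -> vord (transverse_field f i j k) p n Q ->
  ev wronskian p = 0.
Proof.
move=> bQ Q0 vQ; rewrite /ev -(det_map_mx (meval (fun j => p 0 j))).
rewrite -det_tr; apply/eqP/det0P.
exists (\row_c Q@_(ffmon (enum_val c))).
  apply: contraNneq Q0 => /rowP e; rewrite (box_monE bQ) big1 // => c _.
  by have := e c; rewrite !mxE => ->; rewrite scale0r.
apply/rowP => l; rewrite !mxE -[RHS](vQ l (ltn_ord l)) [in RHS](box_monE bQ) viter_sum ev_sum.
by apply: eq_bigr => c _; rewrite !mxE viterZ evZ.
Qed.

(* Fraction-free version of: a matrix with vanishing determinant has dependent rows. *)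
Lemma wronskian_relation : rdvd f wronskian ->
  exists (s : nat) (v : 'I_s.+1 -> P), [/\ (s < n)%N, ~ rdvd f (v ord_max) &
    forall Q, box d Q -> rdvd f (\sum_l v l * Xn l Q)].
Proof.
have [_ f1 _] := pf; move=> fW.
(* Some minor on the first [s] rows is nonzero modulo [f]. Where this holds for [s] but not for
   [s.+1], the cofactors along the added column are the coefficients of the relation. *)
pose indep s := exists J : 'I_s -> 'I_n, ~ rdvd f (\det (\matrix_(l < s, c < s) Xn l (box_mon (J c)))).
have i0 : indep 0%N.
  have J0 : 'I_0 -> 'I_n by case.
  by exists J0; rewrite det_mx00.
have nin : ~ indep n.
  move=> [J]; apply.
  have -> : \matrix_(l < n, c < n) Xn l (box_mon (J c)) =
     (\matrix_(l < n, c < n) Xn l (box_mon c)) *m (\matrix_(l < n, c < n) (l == J c)%:R).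
    apply/matrixP => l c; rewrite !mxE (bigD1 (J c)) //= !mxE eqxx mulr1 big1 ?addr0 // => c' /negPf cc.
    by rewrite !mxE cc mulr0.
  by rewrite det_mulmx; exact: rdvd_mulr.
have [s sn [[J HJ] nS]] : exists2 s, (s < n)%N & indep s /\ ~ indep s.+1.
  have first m : ~ indep m -> exists2 s, (s < m)%N & indep s /\ ~ indep s.+1.
    elim: m => [//|m IH] nm.
    have [im|/IH[s sm H]] := pselect (indep m); first by exists m.
    by exists s => //; exact: leqW.
  exact: first.
pose v : 'I_s.+1 -> P := fun l => (-1) ^+ (l + s) *
  \det (\matrix_(x < s, y < s) Xn (lift l x) (box_mon (J y))).
exists s, v; split=> //.
  rewrite /v addnn -mul2n exprM sqrrN !expr1n mul1r.
  rewrite (_ : \matrix_(x, y) _ = \matrix_(x < s, y < s) Xn x (box_mon (J y))) //.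
  by apply/matrixP => x y; rewrite !mxE lift_max.
have col c : rdvd f (\sum_l v l * Xn l (box_mon c)).
  pose J' (y : 'I_s.+1) := if unlift ord_max y is Some y' then J y' else c.
  apply: contrapT => H; apply: nS; exists J'; rewrite (expand_det_col _ ord_max).
  set B := \matrix_(l, y) _.
  have e1 l : B l ord_max = Xn l (box_mon c) by rewrite mxE /J' unlift_none.
  have e2 l : cofactor B l ord_max = v l.
    rewrite /cofactor /v; congr (_ * \det _); apply/matrixP => x y.
    by rewrite [LHS]mxE [LHS]mxE [LHS]mxE [RHS]mxE /J' liftK.
  by under eq_bigr => l _ do rewrite e1 e2 mulrC.
move=> Q bQ; rewrite (box_monE bQ).
have -> : \sum_l v l * Xn l (\sum_(c < n) Q@_(ffmon (enum_val c)) *: box_mon c) =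
   \sum_(c < n) Q@_(ffmon (enum_val c)) *: \sum_l v l * Xn l (box_mon c).
  under eq_bigr do rewrite viter_sum mulr_sumr.
  rewrite exchange_big /=; apply: eq_bigr => c _; rewrite scaler_sumr.
  by apply: eq_bigr => l _; rewrite viterZ -scalerAr.
by apply: rdvd_sum => c _; rewrite -mul_mpolyC; apply: rdvd_mull.
Qed.

(** Otherwise every [Q] of the box satisfies on [Z(f)] a linear differential equation of order
    [s < n] along the field. Where its leading coefficient is nonzero, some [Q != 0] meets [s] zero
    initial conditions; by uniqueness all its iterates vanish there, and [on_curve_rdvd] makes it a
    multiple of [f]. *)
Lemma wronskian_indivisible : (forall Q, box d Q -> Q != 0 -> ~ rdvd f Q) ->
  ~ rdvd f f^`M(k) -> (forall l, ~ rdvd f 'X_l) -> ~ rdvd f wronskian.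
Proof.
move=> fbox ffk fX fW; have [_ f1 fP] := pf.
have [s [v [sn vs rel]]] := wronskian_relation fW.
have [p [fp gp]] : exists p, ev f p = 0 /\ ev (v ord_max * (f^`M(k) * ('X_i * 'X_j))) p <> 0.
  apply: contrapT => H; have : rdvd f (v ord_max * (f^`M(k) * ('X_i * 'X_j))).
    apply: surface_nullstellensatz => // x fx; apply: contrapT => gx; apply: H.
    by exists x.
  by case/fP => // /fP[//|/fP[]]; exact: fX.
move/eqP: gp; rewrite !evM !evX !mulf_eq0 !negb_or => /and4P[vp fk pi pj].
have [||Q [Q0 bQ HQ]] := @box_solve K d s (fun l Q => ev (Xn l Q) p).
- move=> l c; rewrite viter_sum ev_sum; apply: eq_bigr => w _.
  by rewrite viterZ evZ.
- by rewrite -card_ffmon.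
apply: (fbox Q bQ Q0); apply: (on_curve_rdvd ij ik jk ijk pf fp fk pi pj).
apply: vord_on_curve => N; apply: (@vord_leq _ _ _ (s + N)); first exact: leq_addl.
(* After [N] derivations of the relation, only its top term survives at [p], with coefficient the
   value of [v ord_max]. *)
elim: N => [|N IH]; first by rewrite addn0 => l ls; exact: (HQ (Ordinal ls)).
rewrite addnS => l; rewrite ltnS leq_eqVlt => /orP[/eqP->|]; last exact: IH.
have f0 := transverse_field_f f ij ik jk ijk.
have := vord_rdvd f0 fp (rel Q bQ) (ltnSn N).
rewrite viter_sum ev_sum (bigD1 ord_max) //= [X in _ + X]big1 ?addr0 => [|l' l'm].
  rewrite viter_lead; last exact: vord_viter.
  by move/eqP; rewrite mulf_eq0 (negPf vp) /viter -iterD addnC => /eqP.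
have ls : (l' < s)%N.
  by rewrite ltn_neqAle -ltnS ltn_ord andbT; apply: contra l'm => /eqP e; apply/eqP/val_inj.
apply: (@vordMl _ _ _ N.+1) => //; apply: vord_viter.
by apply: vord_leq IH; rewrite addnS -addSn leq_add2r.
Qed.

Lemma box_mderiv e l g : box e g -> box e g^`M(l).
Proof.
move=> bg m; rewrite mcoeff_msupp mcoeff_mderiv => c0 l'.
have mg : (m + U_(l))%MM \in msupp g.
  by rewrite mcoeff_msupp; apply: contraNneq c0 => ->; rewrite mul0rn.
by apply: leq_ltn_trans (bg _ mg l'); rewrite mnmDE leq_addr.
Qed.

Lemma box_transverse_field D l : box D.+1 f -> box D.+2 (transverse_field f i j k l).
Proof.
move=> bf; have [b0 bD bZ] := @box_subsp K D.+2.
have b l1 l2 : box D.+2 (f^`M(l1) * 'X_l2).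
  by rewrite -[D.+2]addn2; apply: boxM; [exact: box_mderiv|exact: boxX].
rewrite /transverse_field; case: ifP => _ //; case: ifP => _; first exact: bZ.
by apply: (subspN (@box_subsp K D.+2)); apply: bD => //; exact: bZ.
Qed.

Lemma box_viter D e l g : box D.+1 f -> box e g -> box (l * D.+1 + e) (Xn l g).
Proof.
move=> bf bg; elim: l => [//|l IH]; rewrite /viter iterS -/(viter _ _ _) mulSn -addnA.
have [b0 bD bZ] := @box_subsp K (D.+1 + (l * D.+1 + e)).
rewrite /vfield; apply: (big_ind (box _)) => // l' _.
by apply: boxM; [exact: box_transverse_field|exact: box_mderiv].
Qed.

Lemma box_wronskian D : box D.+1 f -> box (n * (n * D.+1 + d)).+1 wronskian.
Proof.
move=> bf; set B := (n * D.+1 + d)%N.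
have [b0 bD bZ] := @box_subsp K (n * B).+1.
rewrite /wronskian /determinant; apply: (big_ind (box _)) => // s _.
have signed (b : bool) g : box (n * B).+1 g -> box (n * B).+1 ((-1) ^+ b * g).
  by rewrite mulr_sign; case: ifP => _ // bg; exact: subspN (@box_subsp K _) bg.
apply: signed.
rewrite -[X in (X * B)%N](card_ord n) -sum1_card big_distrl /=.
apply: (big_ind2 (fun (Q : P) m => box m.+1 Q)) => [|a m b m' bm bm'|l _].
- by rewrite -(mpolyC1 3); exact: boxC.
- by rewrite -addnS; exact: boxM.
have bm c : box d (box_mon c) by exact: box_ffmon.
rewrite mul1n mxE; apply: (box_leq _ (box_viter bf (bm _))).
by rewrite /B leqW // leq_add2r leq_mul2r ltnW ?orbT // ltn_ord.
Qed.

End Wronskian.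

(** * Rich points *)

Section RichPoints.
Variable K : numClosedFieldType.
Local Notation P := {mpoly K[3]}.
Local Notation pt := 'rV[K]_3.
Implicit Types (f g h Q : P) (p : pt) (A : cset K).

(** The ideal condition covers both the osculating curves of (a) and the contained curves of (b). *)
Definition rich e T N f p := exists gs : seq (cset K), [/\ size gs = T, distinct_sets gs &
  forall l, (l < size gs)%N -> [/\ Ecurve e (nth (@cset0 K) gs l), nth (@cset0 K) gs l p &
    subsum (Iof (nth (@cset0 K) gs l)) (mp p N) f]].

Lemma rich_of_atleast e T N f p (S : cset K -> Prop) : atleast_sets T S ->
    (forall A, S A -> [/\ Ecurve e A, A p & subsum (Iof A) (mp p N) f]) ->
  rich e T N f p.
Proof.
move=> [gs [Tgs dis gsS]] SP; have sz : size (take T gs) = T by rewrite size_takel.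
exists (take T gs); split=> //.
  move=> i j; rewrite sz => iT jT; rewrite !nth_take //; apply: dis; exact: leq_trans Tgs.
by move=> l; rewrite sz => lT; rewrite nth_take //; apply/SP/gsS; exact: leq_trans Tgs.
Qed.

Lemma infinite_points A M : ~ cfinite A -> exists s : seq pt,
  [/\ uniq s, size s = M & forall x, x \in s -> A x].
Proof.
move=> Ainf; elim: M => [|M [s [us ss sA]]]; first by exists [::].
have [x [Ax xs]] : exists x, A x /\ x \notin s.
  apply: contrapT => H; apply: Ainf; exists s => x Ax; apply: contrapT => /negP xs.
  by apply: H; exists x.
exists (x :: s); split=> /=; [by rewrite xs us|by rewrite ss|].
by move=> y; rewrite inE => /orP[/eqP->|/sA].
Qed.

Lemma sample_points (gs : seq (cset K)) M :
    (forall l, (l < size gs)%N -> ~ cfinite (nth (@cset0 K) gs l)) ->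
  exists pts : seq pt, size pts = (size gs * M)%N /\ forall l, (l < size gs)%N ->
    exists s : seq pt, [/\ uniq s, size s = M, {subset s <= pts} &
      forall x, x \in s -> nth (@cset0 K) gs l x].
Proof.
elim: gs => [|A gs IH] inf; first by exists [::].
have [pts [sp ptsP]] := IH (fun l lg => inf l.+1 lg).
have [s [us ss sA]] := infinite_points M (inf 0%N isT).
exists (s ++ pts); split; first by rewrite size_cat ss sp mulSn.
move=> [|l] lg.
  by exists s; split=> // x xs; rewrite mem_cat xs.
have [s' [us' ss' s'p s'A]] := ptsP l lg; exists s'; split=> // x /s'p xp.
by rewrite mem_cat xp orbT.
Qed.

(** [Q] is required to vanish at one more point of each curve than Bezout allows. *)
Lemma low_degree_through_curves e d (gs : seq (cset K)) : (0 < e)%N ->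
    (forall l, (l < size gs)%N -> Ecurve e (nth (@cset0 K) gs l)) ->
    (size gs * (32 * (e * e) * d).+1 < d ^ 3)%N ->
  exists Q, [/\ Q != 0, box d Q & forall l, (l < size gs)%N -> Iof (nth (@cset0 K) gs l) Q].
Proof.
move=> e0 cgs lt.
have [|pts [sp ptsP]] := @sample_points gs (32 * (e * e) * d).+1.
  by move=> l /cgs[[_ inf _] _].
have [||Q [Q0 bQ HQ]] := @box_solve K d (size pts) (fun x Q => ev Q pts`_x).
- by move=> x c; rewrite ev_sum; apply: eq_bigr => w _; rewrite evZ.
- by rewrite sp.
exists Q; split=> // l lg; apply: contrapT => nQ.
have [s [us ss spts sA]] := ptsP l lg.
have : (size s <= 32 * (e * e) * d)%N.
  apply: (curve_bezout e0 (cgs l lg) nQ (box_leq (leqnSn d) bQ) us) => x xs.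
  split; first exact: sA.
  have := spts x xs => /(nthP 0)[y ly <-]; exact: (HQ (Ordinal ly)).
by rewrite ss ltnn.
Qed.

(** [Q] lies in the ideal of [A] plus [mp p T], of codimension at least [T]; a [Q] not vanishing on
    [A] would leave at most [32 e^2 d] dimensions. *)
Lemma order_on_curve e d T N f Q p A : (0 < e)%N -> Ecurve e A -> A p -> (T <= N)%N ->
    (32 * (e * e) * d < T)%N -> box d Q ->
    subsum (Iof A) (mp p N) f -> subsum (rdvd f) (mp p T) Q -> Iof A Q.
Proof.
move=> e0 cA Ap TN dT bQ [a [b [Ia mb ef]]] [_ [w [[x ->] mw eQ]]].
have pI := irr_curve_prime cA.1; have [iI _ _] := pI.
have [l nl] := irr_curve_coord p cA.1.
have iZ := ideal_subsum iI (ideal_mp p T); have [_ ZD ZM] := iZ.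
have QZ : subsum (Iof A) (mp p T) Q.
  rewrite eQ; apply: (ZD); last by apply: subsumr mw; exact: ideal_subsp.
  by apply: (ZM); exists a, b; split=> //; exact: mp_leq mb.
apply: contrapT => nQ.
have : (T <= 32 * (e * e) * d)%N; last by rewrite leqNgt dT.
apply: (thin_codim pI (Ecurve_thin e0 cA) nQ (box_leq (leqnSn d) bQ)).
have := local_dim T pI (fun g Ig => Ig p Ap) nl; apply: dim_geS => // _ [y [_ [Iy [z ->] ->]]].
apply: (ZD); last exact: ZM.
by apply: subsuml Iy; exact/ideal_subsp/ideal_mp.
Qed.

Variables (f : P) (i j k : 'I_3).
Hypotheses (ij : i != j) (ik : i != k) (jk : j != k).
Hypothesis ijk : forall l, [\/ l = i, l = j | l = k].

Lemma rich_wronskian e d T T' N p : (0 < e)%N -> (32 * (e * e) * d < T')%N ->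
    (T' * (32 * (e * e) * d).+1 < d ^ 3)%N -> (T' <= T)%N -> (d ^ 3 <= T)%N ->
    (T * (32 * (e * e) * (T * e)) < N)%N ->
    (T <= N)%N -> rich e T N f p -> ev f p = 0 -> ev f^`M(k) p != 0 ->
  ev (wronskian f i j k d) p = 0.
Proof.
move=> e0 dT' T'd T'T dT TN TN' [gs [sz dis gsP]] fp fk.
have szt : size (take T' gs) = T' by rewrite size_takel // sz.
have lt l : (l < T')%N -> (l < size gs)%N by move=> lT; rewrite sz; exact: leq_trans T'T.
have [||Q [Q0 bQ Qt]] := @low_degree_through_curves e d (take T' gs) e0.
- by move=> l; rewrite szt => lT; rewrite nth_take //; have [] := gsP l (lt l lT).
- by rewrite szt.
have sub A (g : P) : Iof A g -> subsum (Iof A) (mp p N) g.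
  by move=> H; apply: subsuml H; exact/ideal_subsp/ideal_mp.
have : subsum (rdvd f) (mp p T') Q.
  rewrite -szt; apply: (local_membership ij ik jk ijk fp fk e0 (N := N)).
  - by rewrite szt; apply: leq_ltn_trans TN; rewrite !leq_mul.
  - move=> a b; rewrite szt => aT bT; rewrite !nth_take //; apply: dis; exact: lt.
  - by move=> l; rewrite szt => lT; rewrite nth_take //; have [] := gsP l (lt l lT).
  - by move=> l; rewrite szt => lT; rewrite nth_take //; have [] := gsP l (lt l lT).
  - by move=> l lT; apply/sub/Qt.
move=> QT'; have Qall l : (l < size gs)%N -> Iof (nth (@cset0 K) gs l) Q.
  move=> lg; have [cA Ap fA] := gsP l lg.
  exact: (order_on_curve e0 cA Ap (leq_trans T'T TN') dT' bQ fA QT').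
have [x [y [fx my eQ]]] : subsum (rdvd f) (mp p T) Q.
  rewrite -sz; apply: (local_membership ij ik jk ijk fp fk e0 (N := N)) => //.
  - by rewrite sz.
  - by move=> l lg; have [] := gsP l lg.
  - by move=> l lg; have [] := gsP l lg.
  - by move=> l lg; apply/sub/Qall.
(* The field annihilates [f], so the multiple of [f] has infinite order along it; the rest has order
   at least [n]. *)
apply: (wronskian_eq0 bQ Q0); rewrite eQ card_ffmon.
apply: vordD; first exact: vord_rdvd (transverse_field_f f ij ik jk ijk) fp fx.
by apply: vord_mp; exact: mp_leq my.
Qed.

End RichPoints.

(** * Counting curves with many rich points *)

Section FewRichCurves.
Variable K : numClosedFieldType.
Local Notation P := {mpoly K[3]}.
Implicit Types (f g h Q : P).

Lemma msize_mderiv_lt f l : f != 0 -> (msize f^`M(l) < msize f)%N.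
Proof.
rewrite -msize_poly_eq0; case E: (msize f) => [//|M] _.
rewrite ltnS msizeE; apply/bigmax_leqP_seq => m mf _.
have mf' : (m + U_(l))%MM \in msupp f.
  by move: mf; rewrite !mcoeff_msupp mcoeff_mderiv; apply: contraNneq => ->; rewrite mul0rn.
by have := msize_mdeg_lt mf'; rewrite E mdegD mdeg1 addn1 ltnS.
Qed.

Lemma mderiv_neq0 f l m : m \in msupp f -> m l != 0%N -> f^`M(l) != 0.
Proof.
move=> mf ml; apply/eqP => /(congr1 (mcoeff (m - U_(l))%MM)).
rewrite mcoeff_mderiv mcoeff0 (_ : (m - U_(l) + U_(l))%MM = m); last first.
  by apply/mnmP => l'; rewrite mnmDE mnmBE mnm1E; case: eqP => [<-|_] /=; move: ml; lia.
by move/eqP; rewrite mulrn_eq0 /= mcoeff_eq0 mf.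
Qed.

Lemma box_msize_le d Q : box d Q -> (msize Q <= (3 * d).+1)%N.
Proof.
move=> bQ; rewrite msizeE; apply/bigmax_leqP_seq => m mQ _; rewrite ltnS mdegE.
apply: leq_trans (_ : (\sum_(l < 3) d <= _)%N); last by rewrite sum_nat_const card_ord.
by apply: leq_sum => l _; exact/ltnW/bQ.
Qed.

(** [w D] bounds the degree of [Psi] in each variable and [c1] exceeds [32 e^2 w], so a curve with
    [c1 D] rich points lies in [Z(Psi)]; at most [32 w D^2] curves lie in both surfaces. *)
Lemma few_rich_curves e d n T T' N D f (gs : seq (cset K)) : (0 < e)%N -> n = (d ^ 3)%N ->
    (32 * (e * e) * d < T')%N ->
    (T' * (32 * (e * e) * d).+1 < n)%N -> (T' <= T)%N -> (n <= T)%N ->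
    (T * (32 * (e * e) * (T * e)) < N)%N -> (T <= N)%N ->
    prime_elt f -> msize f = D.+1 -> (3 * d + 2 <= D)%N ->
    let w := (n * (2 * n + d) + 1)%N in let c1 := (32 * (e * e) * w + 1)%N in
    distinct_sets gs ->
    (forall l, (l < size gs)%N -> [/\ Ecurve e (nth (@cset0 K) gs l),
       Iof (nth (@cset0 K) gs l) f & exists s : seq 'rV[K]_3, [/\ uniq s, (c1 * D <= size s)%N &
         forall x, x \in s -> nth (@cset0 K) gs l x /\ rich e T N f x]]) ->
  (size gs < c1 * D ^ 2)%N.
Proof.
move=> e0 nE dT' T'd T'T nT TN TN' pf sf dD w c1 dis gsP.
have [/eqP f0 f1 fP] := pf; have D0 : (0 < D)%N by move: dD; lia.
have [k [m [mf mk]]] := prime_var pf; have [i [j [ij ik jk ijk]]] := other_var k.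
have fk0 : f^`M(k) != 0 := mderiv_neq0 mf mk.
have nfk : ~ rdvd f f^`M(k).
  by move/(rdvd_msize fk0); rewrite leqNgt msize_mderiv_lt.
have nW : ~ rdvd f (wronskian f i j k d).
  apply: wronskian_indivisible => // [Q bQ Q0 /(rdvd_msize Q0)|l].
    by move=> h; have := leq_trans h (box_msize_le bQ); rewrite sf; move: dD; lia.
  have X0 : 'X_l != 0 :> P by have := XsubC_neq0 (K := K) l 0; rewrite subr0.
  by move/(rdvd_msize X0); rewrite sf msizeX mdeg1; move: dD; lia.
(* The derivative takes care of the points where [f] cannot be solved for coordinate [k]. *)
pose Psi := wronskian f i j k d * f^`M(k).
have nPsi : ~ rdvd f Psi by case/fP.
have bf : box D.+1 f by apply: box_msize; rewrite sf.
have bPsi : box (w * D).+1 Psi.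
  have bW := @box_wronskian K f i j k d D bf; rewrite card_ffmon -nE in bW.
  rewrite /Psi; apply: (box_leq _ (boxM bW (box_mderiv (l := k) bf))); rewrite addnS ltnS.
  (* [D + 1 <= 2 D] accounts for the 2 in [w], and the derivative of [f] for the final 1. *)
  by rewrite /w; move: D0; clear; case: D => [//|D] _; nia.
have PsiI l : (l < size gs)%N -> Iof (nth (@cset0 K) gs l) Psi.
  move=> lg; have [cA fA [s [us ss sP]]] := gsP l lg; apply: contrapT => nI.
  have : (size s <= 32 * (e * e) * (w * D))%N.
    apply: (curve_bezout e0 cA nI bPsi us) => x /sP[Ax rx]; split=> //.
    rewrite evM; have [->|fk] := eqVneq (ev f^`M(k) x) 0; first by rewrite mulr0.
    rewrite (rich_wronskian ij ik jk ijk e0 dT' _ T'T _ TN TN' rx (fA x Ax) fk) ?mul0r -?nE //.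
  move=> h; have := leq_trans ss h; rewrite /c1; move: D0; clear.
  by rewrite mulnDl mul1n !mulnA; lia.
have wD0 : (0 < w * D)%N by rewrite muln_gt0 D0 /w addn1.
have := curves_bezout (thin_pair pf nPsi D0 wD0 bf bPsi) dis _ _.
move=> h; apply: (leq_ltn_trans (h _ _)).
- by move=> l lg; have [[]] := gsP l lg.
- move=> l lg _ [_ [_ [[x ->] [y ->] ->]]]; have [_ fA _] := gsP l lg.
  have [_ ID IM] := ideal_Iof (nth (@cset0 K) gs l).
  exact: (ID _ _ (IM _ _ fA) (IM _ _ (PsiI l lg))).
rewrite /c1 (_ : 32 * (D * (w * D)) = 32 * w * D ^ 2)%N; last by ring.
have e1 : (32 * w <= 32 * (e * e) * w)%N by rewrite leq_mul2r leq_pmulr ?muln_gt0 ?e0 ?orbT.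
by rewrite ltn_pmul2r ?expn_gt0 ?D0 // addn1 ltnS.
Qed.

Lemma maximal_family (S : cset K -> Prop) M :
    (forall gs, distinct_sets gs -> (forall l, (l < size gs)%N -> S (nth (@cset0 K) gs l)) ->
      (size gs < M)%N) ->
  exists gs, (size gs < M)%N /\
    forall A, S A -> exists2 l, (l < size gs)%N & cseteq A (nth (@cset0 K) gs l).
Proof.
move=> bound.
pose ok gs := distinct_sets gs /\ forall l, (l < size gs)%N -> S (nth (@cset0 K) gs l).
suff main m : forall gs, ok gs -> (M - size gs <= m)%N ->
    exists gs, ok gs /\ forall A, S A -> exists2 l, (l < size gs)%N & cseteq A (nth (@cset0 K) gs l).
  have [|gs [[dis gsS] H]] := main M [::] _ (leq_subr _ _); first by split.
  by exists gs; split=> //; exact: bound.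
elim: m => [|m IH] gs [dis gsS] hm.
  by have := bound gs dis gsS; move: hm; rewrite leqn0 subn_eq0 leqNgt => /negP.
have [H|/existsNP[A /not_implyP[SA nA]]] := pselect (forall A, S A ->
    exists2 l, (l < size gs)%N & cseteq A (nth (@cset0 K) gs l)); first by exists gs.
have nl l : (l < size gs)%N -> ~ cseteq A (nth (@cset0 K) gs l).
  by move=> lg H; apply: nA; exists l.
apply: (IH (A :: gs)); last by move: hm => /=; lia.
split; last by move=> [|l] // /gsS.
move=> [|a] [|b] //= ag bg ab; first exact: nl.
- by move=> H; apply: (nl a ag) => x; have := H x; tauto.
- exact: dis.
Qed.

End FewRichCurves.

(** * Parametrized families and the choice of constants *)

Section Families.
Variable K : numClosedFieldType.
Variable E : nat.

Lemma msize_gpoly (u : 'rV[K]_(Npar E)) j : (msize (gpoly u j) <= E.+1)%N.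
Proof.
rewrite (leq_trans (msize_sum _ _ _)) //; apply/bigmax_leqP_seq => m _ _.
by rewrite (leq_trans (mmeasureZ_le _ _ _)) // msizeX; exact: bmdeg.
Qed.

Lemma curve_family_Ecurve (S : 'rV[K]_(Npar E) -> Prop) g : curve_family S g -> Ecurve E.+1 g.
Proof.
move=> [[cg _] [u [_ gu]]]; split=> //; exists [seq gpoly u j | j <- enum {: Mon E}]; split.
  by move=> q /mapP[j _ ->]; exact/leqW/msize_gpoly.
move=> x; split=> [/gu Zx q /mapP[j _ ->]|H]; first exact: Zx.
by apply/gu => j; apply: H; apply: map_f; rewrite mem_enum.
Qed.

End Families.

Theorem theorem1p13 :
  forall (R : realType) (E : nat), exists D0 : nat, forall c : nat,
  exists c1 r t : nat,
  forall (f : {mpoly R[i][3]}) (D : nat) (S : 'rV[R[i]]_(Npar E) -> Prop),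
    mirreducible f -> msize f = D.+1 -> (D0 <= D)%N ->
    constructible c S ->
    (* (a) *)
    (atleast_sets (c1 * D ^ 2)%N
       (fun g => [/\ curve_family S g, csub g (Zf f) &
          atleast_pts (c1 * D)%N (fun p => g p /\ flecnode t (curve_family S) r f p)])
     -> inf_ruled (curve_family S) f)
    /\
    (* (b) *)
    (~ inf_ruled (curve_family S) f ->
     exists exc : seq (cset R[i]),
       (size exc <= c1 * D ^ 2)%N /\
       forall g : cset R[i], curve_family S g -> csub g (Zf f) ->
         (forall k, (k < size exc)%N -> ~ cseteq g (nth (@cset0 _) exc k)) ->
         forall s : seq (pt R[i]), uniq s ->
           (forall p, p \in s ->
              g p /\ atleast_sets t (fun h => [/\ curve_family S h, csub h (Zf f) & h p])) ->
           (size s <= c1 * D)%N).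
Proof.
(* [E.+1] keeps [e] positive. The parameter count needs [d > (b + 1)^2], since
   [T' (b d + 1) <= (b + 1)^2 d^2]. *)
move=> R E; pose e := E.+1; pose b := (32 * (e * e))%N; pose d := (b.+1 ^ 2).+1.
exists (3 * d + 2)%N => c.
(* [T'] just exceeds Bezout's bound on one curve, [T] also reaches the order [n], and [N] outweighs
   a loss of [b T e] on each of [T] curves. *)
pose n := (d ^ 3)%N; pose T' := (b * d).+1; pose T := (T' + n)%N.
pose N := (T * (b * (T * e)) + T)%N.+1.
pose w := (n * (2 * n + d) + 1)%N; pose c1 := (b * w + 1)%N.
have T'd : (T' * (b * d).+1 < n)%N.
  have h : ((b * d).+1 <= b.+1 * d)%N by rewrite mulSn -add1n leq_add2r.
  apply: leq_ltn_trans (leq_mul h h) _.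
  rewrite (_ : b.+1 * d * (b.+1 * d) = b.+1 ^ 2 * d ^ 2)%N; last by rewrite !expnS !expn0; lia.
  by rewrite /n [(d ^ 3)%N]expnS ltn_pmul2r // expn_gt0.
(* Osculation to order [r] means vanishing to order [r.+1], hence [N.-1]. *)
exists c1, N.-1, T => f D S irr sf dD _.
have pf := mirreducible_prime irr.
have few gs : distinct_sets gs ->
    (forall l, (l < size gs)%N -> [/\ curve_family S (nth (@cset0 R[i]) gs l),
       csub (nth (@cset0 R[i]) gs l) (Zf f) & exists s : seq 'rV[R[i]]_3,
       [/\ uniq s, (c1 * D <= size s)%N &
         forall x, x \in s -> nth (@cset0 R[i]) gs l x /\ rich e T N f x]]) ->
  (size gs < c1 * D ^ 2)%N.
  have TN : (T * (b * (T * e)) < N)%N by rewrite /N ltnS leq_addr.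
  have TN' : (T <= N)%N by rewrite /N leqW // leq_addl.
  move=> dis gsP; apply: (few_rich_curves (ltn0Sn E) (erefl n) (ltnSn _) T'd (leq_addr _ _)
    (leq_addl _ _) TN TN' pf sf dD dis).
  by move=> l /gsP[cg gf sP]; split=> //; exact: curve_family_Ecurve cg.
split=> [[gs [sz dis gsP]]|_].
  have := few gs dis _; rewrite ltnNge sz => H; exfalso; suff : false by []; apply: H => l lg.
  have [cg gf [s [ss us sP]]] := gsP l lg; split=> //; exists s; split=> // x /sP[gx [fx flec]].
  split=> //; apply: rich_of_atleast flec _ => g [cg' [gx' _] [h [Ih van]]].
  split=> //; first exact: curve_family_Ecurve cg'.
  exists h, (f - h); split=> //; last by rewrite addrC subrK.
  exact: vanishes_to_mp van.
(* The exceptional curves form a maximal family of distinct curves with at least [c1 D] rich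
   points. *)
have [exc [sz H]] := @maximal_family _ (fun g => [/\ curve_family S g, csub g (Zf f) &
   exists s : seq 'rV[R[i]]_3, [/\ uniq s, (c1 * D <= size s)%N &
         forall x, x \in s -> g x /\ rich e T N f x]]) (c1 * D ^ 2) few.
exists exc; split; first exact: ltnW.
move=> g cg gf nex s us sP; rewrite leqNgt; apply/negP => lt.
have [|l lx gl] := H g; last exact: nex gl.
split=> //; exists s; split=> //; first exact: ltnW.
move=> x /sP[gx at_x]; split=> //; apply: rich_of_atleast at_x _ => h [ch hf hx].
split=> //; first exact: curve_family_Ecurve ch.
(* A curve contained in [Z(f)] has [f] in its ideal, so it osculates to every order. *)
by apply: subsuml; [exact/ideal_subsp/ideal_mp|exact: hf].
Qed.
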